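(* Let $X$ be a separable Banach space with Property($M$). Then the following are equivalent. (a) $c_0 \not\hookrightarrow X$, i.e. $X$ contains no subspace isomorphic to $c_0$. (b) $X$ has weak normal structure. (c) $X$ has Property($K$). (d) $X$ has a Kadec-Klee norm. (e) $r_X(1) > 0$, where $r_X$ is Opial's modulus of $X$.
   Context: Throughout, $x_n \rightharpoonup x$ denotes weak convergence of a sequence in $X$. Property($M$): $X$ has Property($M$) if whenever $x_n \rightharpoonup 0$ and $u, v \in X$ satisfy $\|u\| \leq \|v\|$, then $\limsup_{n\to\infty}\|x_n+u\| \leq \limsup_{n\to\infty}\|x_n+v\|$. Weak normal structure: every weakly compact convex subset $C$ of $X$ with more than one point contains a point $x_0 \in C$ with $\sup_{y\in C}\|x_0-y\| < \operatorname{diam}(C)$. Property($K$): there exists $K \in [0,1)$ such that whenever $x_n \rightharpoonup 0$, $\lim_{n\to\infty}\|x_n\| = 1$ and $\liminf_{n\to\infty}\|x_n - x\| \leq 1$, then $\|x\| \leq K$. It is implicit in this definition that $X$ cannot have the Schur property (the property that every weakly convergent sequence converges in norm); that is, a space with the Schur property is not regarded as having Property($K$). Kadec-Klee norm: whenever $x_n \rightharpoonup x$ and $\|x_n\| \to \|x\|$, then $\|x_n - x\| \to 0$. Opial's modulus: for $c \geq 0$, $$r_X(c) = \inf\{\liminf_{n\to\infty}\|x_n - x\| - 1 : \|x\| \geq c,\ x_n \rightharpoonup 0,\ \liminf_{n\to\infty}\|x_n\| \geq 1\}.$$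
   Formalization: Condition (c) enters the equivalence only when X is not a Schur space, since Schur spaces (e.g. X = ℝ) satisfy (a) and Property(M) but by convention lack Property(K); (a), (b), (d), (e) are shown equivalent for every such X. *)

(* Defs.v *)
From HB Require Import structures.
From mathcomp Require Import all_boot all_order all_algebra.
From mathcomp Require Import all_classical all_reals all_analysis.

Set Implicit Arguments.
Unset Strict Implicit.
Unset Printing Implicit Defensive.

Import Order.TTheory GRing.Theory Num.Theory.
Import numFieldTopology.Exports numFieldNormedType.Exports.

Local Open Scope classical_set_scope.
Local Open Scope ring_scope.

Section c0_space.
Variable R : realType.

Definition c0_pred : {pred nat -> R^o} := fun u => `[< u @ \oo --> (0 : R) >].

Lemma c0_submod_closed : submod_closed c0_pred.
Proof.
split=> [|a u v].
  by apply/asboolP; exact: cvg_cst.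
move=> /asboolP u0 /asboolP v0; apply/asboolP.
rewrite -[X in _ --> X]addr0; apply: (@cvgD _ R^o) => //.
by rewrite -[X in _ --> X](scaler0 _ a); exact: (@cvgZr _ R^o).
Qed.

HB.instance Definition _ :=
  GRing.isSubmodClosed.Build R (nat -> R^o) c0_pred c0_submod_closed.

(* c_0 over the reals, normed below by the supremum norm. *)
Record c0 := C0 { c0_seq :> nat -> R^o; c0_seqP : c0_seq \in c0_pred }.

HB.instance Definition _ := [isSub for c0_seq].
HB.instance Definition _ := [Choice of c0 by <:].
HB.instance Definition _ := [SubChoice_isSubLmodule of c0 by <:].

Definition c0_norm (u : c0) : R := sup (range (fun n => `|u n|)).

Lemma c0_has_sup (u : c0) : has_sup (range (fun n => `|u n|)).
Proof.
split; first by exists `|u 0%N|, 0%N.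
have /asboolP/cvgP/cvg_seq_bounded[M [_ /(_ (M + 1))]] := c0_seqP u.
rewrite ltrDl ltr01 => /(_ isT) uM.
by exists (M + 1) => _ [n _ <-]; exact: uM.
Qed.

Lemma c0_le_norm (u : c0) n : `|u n| <= c0_norm u.
Proof. by apply: sup_upper_bound; [exact: c0_has_sup|exists n]. Qed.

Lemma c0_norm_le (u : c0) M : (forall n, `|u n| <= M) -> c0_norm u <= M.
Proof.
move=> uM; apply: ge_sup; first by exists `|u 0%N|, 0%N.
by move=> _ [n _ <-].
Qed.

Lemma c0_normD (u v : c0) : c0_norm (u + v) <= c0_norm u + c0_norm v.
Proof.
apply: c0_norm_le => n; apply: le_trans (ler_normD (u n) (v n)) _.
by apply: lerD; exact: c0_le_norm.
Qed.

Lemma c0_normZ (a : R) (u : c0) : c0_norm (a *: u) = `|a| * c0_norm u.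
Proof.
have leZ (b : R) (v : c0) : c0_norm (b *: v) <= `|b| * c0_norm v.
  apply: c0_norm_le => n; have -> : (b *: v) n = b * v n by [].
  by rewrite normrM ler_wpM2l// c0_le_norm.
apply/le_anti; rewrite leZ /=.
have [->|a0] := eqVneq a 0.
  by rewrite normr0 mul0r; apply: le_trans (c0_le_norm _ 0%N).
rewrite -ler_pdivlMl ?normr_gt0// -normfV.
by apply: le_trans (leZ _ _); rewrite scalerA mulVf// scale1r.
Qed.

Lemma c0_norm_eq0 (u : c0) : c0_norm u = 0 -> u = 0.
Proof.
move=> u0; apply/val_inj/funext => n; apply/normr0_eq0/le_anti.
by rewrite normr_ge0 andbT -u0; exact: c0_le_norm.
Qed.

HB.instance Definition _ :=
  Lmodule_isNormed.Build R c0 c0_normD c0_normZ c0_norm_eq0.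

End c0_space.

Section banach_space_properties.
Variables (R : realType) (X : normedModType R).
Implicit Types (x : nat -> X) (u v y : X).

Definition dual : Type := {f : {linear X -> R^o} | continuous f}.

(* The coarsest topology on X making every f : dual continuous. *)
Definition weak_topology : Type :=
  @sup_topology X dual
    (fun f => Topological.class (initial_topology (sval f : X -> R^o))).

HB.instance Definition _ := Topological.on weak_topology.

Definition weak_cvg x y := x @ \oo --> (y : weak_topology).

Lemma weak_cvgP x y : weak_cvg x y <->
  forall f : {linear X -> R^o}, continuous f -> f (x n) @[n --> \oo] --> f y.
Proof.
split=> [xy f cf|xy].
  have /cvg_sup/(_ (exist _ f cf)) xyf := xy.
  exact: (cvg_comp _ _ xyf (@initial_continuous _ _ _ y)).
apply/cvg_sup => -[f cf] A /=; rewrite (@nbhsE (initial_topology (f : X -> R^o))) => -[_ [[B Bo <-] Bfy] BA].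
by apply: filterS BA _; exact: (xy f cf B (open_nbhs_nbhs (conj Bo Bfy))).
Qed.

Definition separable := exists2 D : set X, countable D & dense D.

Definition property_M := forall x u v,
  weak_cvg x 0 -> `|u| <= `|v| ->
  (limn_esup (fun n => `|x n + u|%:E) <= limn_esup (fun n => `|x n + v|%:E))%E.

(* The range of such a T is a subspace isomorphic to c_0, and conversely. *)
Definition contains_c0 := exists (T : {linear c0 R -> X}) (m M : R),
  0 < m /\ forall a : c0 R, m * `|a| <= `|T a| <= M * `|a|.

(* Suprema are taken in \bar R since [sup] is 0 on unbounded sets. *)
Definition diam (C : set X) : \bar R :=
  ereal_sup [set `|p.1 - p.2|%:E | p in C `*` C].

Definition weak_normal_structure := forall C : set X,
  compact (C : set weak_topology) -> convex_set C ->
  (exists u v, [/\ C u, C v & u != v]) ->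
  exists2 x0, C x0 & (ereal_sup [set `|x0 - y|%:E | y in C] < diam C)%E.

Definition schur := forall x y, weak_cvg x y -> x @ \oo --> y.

(* Without [~ schur] the second clause holds vacuously in Schur spaces. *)
Definition property_K := ~ schur /\
  exists2 K : R, 0 <= K < 1 & forall x y,
    weak_cvg x 0 -> `|x n| @[n --> \oo] --> (1 : R) ->
    (limn_einf (fun n => `|x n - y|%:E) <= 1)%E -> `|y| <= K.

Definition kadec_klee := forall x y,
  weak_cvg x y -> `|x n| @[n --> \oo] --> `|y| ->
  `|x n - y| @[n --> \oo] --> (0 : R).

(* In \bar R the infimum over the empty set is +oo: this is the value at c = 1
   when X has the Schur property. *)
Definition opial_modulus (c : R) : \bar R :=
  ereal_inf [set r | exists x y, [/\ c <= `|y|, weak_cvg x 0,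
    (1 <= limn_einf (fun n => `|x n|%:E))%E &
    r = (limn_einf (fun n => `|x n - y|%:E) - 1)%E]].

End banach_space_properties.

(* Main.v *)
Require Import Defs.
From HB Require Import structures.
From mathcomp Require Import all_boot all_order all_algebra.
From mathcomp Require Import all_classical all_reals all_analysis.
From mathcomp Require Import ring lra.

Import Order.TTheory GRing.Theory Num.Theory.
Import numFieldTopology.Exports numFieldNormedType.Exports.

Local Open Scope classical_set_scope.
Local Open Scope ring_scope.

(** Every condition is compared with (e).  If (e) fails, property (M) lets one
    pick, one after the other, points y_k of weakly null sequences such that all
    signed sums of the y_k stay in the unit ball while |y_k| -> 1.  These y_k span
    c_0 almost isometrically, satisfy |y_k - y_j| <= 1 and |y_k + e| -> 1 for every
    unit vector e, and their closed convex hull with 0 is weakly compact and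
    diametral: (a), (c), (d) and (b) all fail.

    Conversely, (e) rules out any sequence bounded below in norm whose signed sums
    are bounded: passing to differences of disjoint pairs multiplies the lower
    bound by a factor larger than 1 and keeps the upper one.  Such sequences come
    from a copy of c_0 and, by (M), from a failure of the Kadec-Klee property, while
    (c) is a rescaling of (e).  If a weakly compact convex C were diametral, choose
    x_n in C asymptotically at distance d = diam C from a dense sequence of C, hence
    from each point of C.  A subsequence converges weakly to some p in C, and then
    z_n = x_n - p is weakly null with |z_n| -> d and |z_n - z_m| <= d, against (e). *)

Set Implicit Arguments.
Unset Strict Implicit.

(** * Sequences: eventual and frequent statements, upper and lower limits *)

Lemma near_inftyP (P : nat -> Prop) :
  (\forall n \near \oo, P n) <-> exists N, forall n, (N <= n)%N -> P n.
Proof.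
split; first by move=> [N _ PN]; exists N => n Nn; apply: PN.
by move=> [N PN]; exists N => // n /=; exact: PN.
Qed.

Lemma frequently_subseq (P : nat -> Prop) : (forall N, exists2 n, (N <= n)%N & P n) ->
  exists2 phi : nat -> nat, (forall n, (n <= phi n)%N) & forall n, P (phi n).
Proof.
move=> PN; have /choice[phi phiP] : forall N, exists n, (N <= n)%N /\ P n.
  by move=> N; have [n ? ?] := PN N; exists n.
by exists phi => n; have [] := phiP n.
Qed.

Lemma ge_id_cvg_infty (phi : nat -> nat) : (forall n, (n <= phi n)%N) -> phi n @[n --> \oo] --> \oo.
Proof.
move=> phin; apply/cvgnyPge => A; apply/near_inftyP; exists A => n An.
exact: leq_trans (phin n).
Qed.

Section limsup.
Variable R : realType.
Implicit Types (u : nat -> \bar R) (c : \bar R).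
Local Open Scope ereal_scope.

Lemma limn_esup_le u c : (\forall n \near \oo, u n <= c) -> limn_esup u <= c.
Proof.
move=> uc; apply: le_trans (ge_ereal_sup _) => //.
  by apply: ereal_inf_lbound; exists [set n | u n <= c].
by move=> _ [n /= ? <-].
Qed.

Lemma limn_esup_lt u c : limn_esup u < c -> \forall n \near \oo, u n < c.
Proof.
move=> /ereal_inf_lt[_ [V FV <-] Vc]; apply: filterS FV => n Vn.
by apply: le_lt_trans Vc; apply: ereal_sup_ubound; exists n.
Qed.

Lemma limn_einf_ge u c : (\forall n \near \oo, c <= u n) -> c <= limn_einf u.
Proof.
move=> cu; rewrite /limn_einf leeNr; apply: limn_esup_le.
by apply: filterS cu => n; rewrite leeN2.
Qed.

Lemma limn_einf_gt u c : c < limn_einf u -> \forall n \near \oo, c < u n.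
Proof.
rewrite /limn_einf lteNr => /limn_esup_lt.
by apply: filterS => n; rewrite lteN2.
Qed.

Lemma limn_einf_lt u c : limn_einf u < c ->
  forall N, exists2 n, (N <= n)%N & u n < c.
Proof.
move=> uc N; apply/not_exists2P => uN; move: uc; apply/negP; rewrite -leNgt.
apply: limn_einf_ge; apply/near_inftyP; exists N => n Nn.
by have [|/negP] := uN n => //; rewrite -leNgt.
Qed.

End limsup.

(** * Weak convergence, and a quantitative form of the positivity of Opial's modulus *)

Section weak.
Variables (R : realType) (X : normedModType R).
Implicit Types (x : nat -> X) (u v y : X).

Lemma continuous_linear_le (f : {linear X -> R^o}) : continuous f ->
  exists2 C : R, 0 < C & forall u, `|f u| <= C * `|u|.
Proof.
move=> /linear_bounded_continuous/linear_boundedP/pinfty_ex_gt0[C C0 Cf].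
by exists C.
Qed.

Lemma linear_le_continuous (f : {linear X -> R^o}) (C : R) :
  (forall u, `|f u| <= C * `|u|) -> continuous f.
Proof.
move=> fC; apply/linear_bounded_continuous/linear_boundedP.
exists C; split; first exact: num_real.
by move=> D CD x; apply: le_trans (fC x) _; rewrite ler_wpM2r// ltW.
Qed.

Lemma weak_cvg_subseq x y (phi : nat -> nat) : (forall n, (n <= phi n)%N) ->
  weak_cvg x y -> weak_cvg (x \o phi) y.
Proof.
move=> phin /weak_cvgP xy; apply/weak_cvgP => f cf.
exact: (cvg_comp _ _ (ge_id_cvg_infty phin) (xy f cf)).
Qed.

Lemma weak_cvgZ (a : R) x y : weak_cvg x y -> weak_cvg (fun n => a *: x n) (a *: y).
Proof.
move=> /weak_cvgP xy; apply/weak_cvgP => f cf.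
rewrite linearZ; under eq_cvg do rewrite linearZ.
by apply: (@cvgZr _ R^o); exact: xy.
Qed.

Lemma weak_cvgZ0 (a : R) x : weak_cvg x 0 -> weak_cvg (fun n => a *: x n) 0.
Proof. by move=> /(weak_cvgZ (a:=a)); rewrite scaler0. Qed.

Lemma weak_cvgDr x y u : weak_cvg x y -> weak_cvg (fun n => x n + u) (y + u).
Proof.
move=> /weak_cvgP xy; apply/weak_cvgP => f cf.
rewrite linearD; under eq_cvg do rewrite linearD.
by apply: (@cvgD _ R^o); [exact: xy|exact: cvg_cst].
Qed.

Lemma weak_cvgB0 x y : weak_cvg x y -> weak_cvg (fun n => x n - y) 0.
Proof. by move=> /(@weak_cvgDr _ _ (- y)); rewrite subrr. Qed.

(** Property (M) in eventual form; the room between [c] and [d] absorbs the passage through upper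
    limits. *)
Lemma property_M_near x u v (c d : R) : property_M X -> weak_cvg x 0 ->
  `|u| <= `|v| -> (\forall n \near \oo, `|x n + v| <= c) -> c < d ->
  \forall n \near \oo, `|x n + u| <= d.
Proof.
move=> MX x0 uv xv cd.
have xvc : (limn_esup (fun n => `|x n + v|%:E) <= c%:E)%E.
  by apply: limn_esup_le; apply: filterS xv => n; rewrite lee_fin.
have /limn_esup_lt : (limn_esup (fun n => `|x n + u|%:E) < d%:E)%E.
  by apply: le_lt_trans (MX _ _ _ x0 uv) _; apply: le_lt_trans xvc _.
by apply: filterS => n; rewrite lte_fin => /ltW.
Qed.

(* The inequality r_X(1) > 0, scaled and without lower limits: as it holds for all
   subsequences of x, a single n suffices. *)
Definition opial_gap (delta : R) := forall x y (s : R), weak_cvg x 0 -> 0 < s ->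
  s <= `|y| -> (forall n, s <= `|x n|) -> exists n, (1 + delta) * s <= `|x n - y|.

Lemma opial_modulus_gap : (0 < opial_modulus X 1)%E ->
  exists2 delta : R, 0 < delta <= 1 & opial_gap delta.
Proof.
move=> r0.
(* Any real strictly below the modulus serves; the cap at 1 covers the value +oo and keeps later
   factors such as [1 - delta / 4] positive. *)
have [delta /andP[d0 d1] dr] : exists2 delta : R,
    0 < delta <= 1 & (delta%:E < opial_modulus X 1)%E.
  move: r0; case: (opial_modulus X 1) => [r| |] //= r0; last first.
    by exists 1; rewrite ?ltry//; lra.
  rewrite lte_fin in r0; exists (Num.min 1 (r / 2)); last first.
    by rewrite lte_fin gt_min; apply/orP; right; lra.
  by rewrite lt_min ge_min lexx/= andbT; apply/andP; split => //; lra.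
exists delta; first exact/andP.
move=> x y s x0 s0 sy sx; apply/not_existsP => xys.
suff /le_lt_trans/(_ dr) : (opial_modulus X 1 <= delta%:E)%E by rewrite ltxx.
have nS (z : X) : `|s^-1 *: z| = s^-1 * `|z| by rewrite normrZ gtr0_norm ?invr_gt0.
apply: (@le_trans _ _ (limn_einf (fun n => `|s^-1 *: x n - s^-1 *: y|%:E) - 1)%E).
  apply: ereal_inf_lbound; exists (fun n => s^-1 *: x n), (s^-1 *: y); split => //.
  - by rewrite nS mulrC ler_pdivlMr// mul1r.
  - exact: weak_cvgZ0.
  - apply: limn_einf_ge; apply: nearW => n.
    by rewrite lee_fin nS mulrC ler_pdivlMr// mul1r.
rewrite leeBlDr// -EFinD; apply: le_trans (limn_einf_sup _) _.
apply: limn_esup_le; apply: nearW => n.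
rewrite lee_fin -scalerBr nS mulrC ler_pdivrMr// (addrC delta).
by have /negP := xys n; rewrite -ltNge => /ltW.
Qed.

(** The infimum provides only lower limits: a subsequence turns them into bounds for all [n], and
    division by [s], slightly below 1, restores the lower bounds 1. *)
Lemma opial_modulus_witness : ~ (0 < opial_modulus X 1)%E -> forall eps : R, 0 < eps ->
  exists x y, [/\ weak_cvg x 0, 1 <= `|y|, forall n, 1 <= `|x n| &
    forall n, `|x n - y| <= 1 + eps].
Proof.
move=> /negP; rewrite -leNgt => r0 eps e0.
wlog e1 : eps e0 / eps <= 1.
  move=> W; have [/W|e1] := leP eps 1; first exact.
  have [//|//|x [y [x0 y1 x1 xy]]] := W 1.
  by exists x, y; split => // n; apply: le_trans (xy n) _; rewrite lerD2l ltW.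
have /ereal_inf_lt[_ [x [y [y1 x0 x1 ->]]]] : (opial_modulus X 1 < (eps / 4)%:E)%E.
  by apply: le_lt_trans r0 _; rewrite lte_fin; lra.
rewrite lteBlDr// -EFinD => xy.
(* Since [eps <= 1], [(1 + eps / 4) / s <= 1 + eps]. *)
pose s : R := 1 - eps / 4; have s0 : 0 < s by rewrite /s; lra.
have /near_inftyP[N xN] : \forall n \near \oo, s <= `|x n|.
  have /limn_einf_gt : (s%:E < limn_einf (fun n => `|x n|%:E))%E.
    by apply: lt_le_trans x1; rewrite lte_fin /s; lra.
  by apply: filterS => n; rewrite lte_fin => /ltW.
have [phi phin phix] := frequently_subseq (limn_einf_lt xy).
pose psi n := phi (n + N)%N.
have psin n : (n <= psi n)%N by apply: leq_trans (phin _); exact: leq_addr.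
have nS (z : X) : `|s^-1 *: z| = s^-1 * `|z| by rewrite normrZ gtr0_norm ?invr_gt0.
exists (fun n => s^-1 *: x (psi n)), (s^-1 *: y); split.
- exact: (weak_cvgZ0 _ (weak_cvg_subseq psin x0)).
- by rewrite nS mulrC ler_pdivlMr// mul1r; apply: le_trans y1; rewrite /s; lra.
- move=> n; rewrite nS mulrC ler_pdivlMr// mul1r; apply: xN.
  by apply: leq_trans (phin _); exact: leq_addl.
- move=> n; rewrite -scalerBr nS mulrC ler_pdivrMr//.
  have := phix (n + N)%N; rewrite lte_fin => /ltW/le_trans; apply.
  by rewrite /s; nra.
Qed.

End weak.

(** * Weakly unconditionally Cauchy sequences *)

Section wuc.
Variables (R : realType) (X : completeNormedModType R).
Implicit Types (z : nat -> X) (a : nat -> R) (B : R).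

(* Weakly unconditionally Cauchy, with constant B. *)
Definition wuc B z := forall N a, (forall i, `|a i| <= 1) ->
  `|\sum_(0 <= i < N) a i *: z i| <= B.

Lemma wuc_ge0 B z : wuc B z -> 0 <= B.
Proof. by move=> /(_ 0%N (fun=> 0)); rewrite big_nil !normr0; apply. Qed.

(** With the signs [Num.sg (f (z i))] as coefficients, [f] maps the signed sum to the sum of the
    [|f (z i)|]. This series is bounded by [C * B], so its terms tend to 0. *)
Lemma wuc_weak_cvg0 B z : wuc B z -> weak_cvg z 0.
Proof.
move=> zB; apply/weak_cvgP => f cf; rewrite linear0.
have [C C0 fC] := continuous_linear_le cf.
apply/(norm_cvg0P _).1/cvg_series_cvg_0.
apply: nondecreasing_is_cvgn; first by apply: nondecreasing_series => *.
exists (C * B) => _ [N _ <-].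
apply: (@le_trans _ _ `|f (\sum_(0 <= i < N) Num.sg (f (z i)) *: z i)|).
  rewrite linear_sum; apply: le_trans (ler_norm _).
  by apply: ler_sum => i _; rewrite linearZ normrEsg.
apply: le_trans (fC _) _; rewrite ler_pM2l//; apply: zB => i.
by rewrite normr_sg lern1 leq_b1.
Qed.

Lemma norm_segment_le (v w : X) (a B : R) : `|a| <= 1 -> `|v + w| <= B ->
  `|v - w| <= B -> `|v + a *: w| <= B.
Proof.
rewrite ler_norml => /andP[a1 a2] vw1 vw2.
have -> : v + a *: w = ((1 + a) / 2) *: (v + w) + ((1 - a) / 2) *: (v - w).
  rewrite !scalerDr scalerN addrACA -scalerDl -scalerBl.
  have -> : (1 + a) / 2 + (1 - a) / 2 = 1 by lra.
  have -> : (1 + a) / 2 - (1 - a) / 2 = a by lra.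
  by rewrite scale1r.
apply: le_trans (ler_normD _ _) _; rewrite !normrZ !ger0_norm; [|lra..].
apply: (@le_trans _ _ ((1 + a) / 2 * B + (1 - a) / 2 * B)); last lra.
by rewrite lerD// ler_wpM2l//; lra.
Qed.

(** Greedy choice: at stage [k] there are finitely many signed sums of the terms chosen so far, so
    one far index serves all of them. Coefficients in [-1, 1] reduce to signs by convexity of the
    norm. *)
Lemma wuc_build (P : nat -> R) (x : nat -> nat -> X) : 0 <= P 0 ->
  (forall k u, `|u| <= P k -> \forall n \near \oo, `|x k n + u| <= P k.+1) ->
  exists phi : nat -> nat, forall N a, (forall i, `|a i| <= 1) ->
    `|\sum_(0 <= i < N) a i *: x i (phi i)| <= P N.
Proof.
move=> P0 xP.
pose ok k (L : seq X) := all (fun u => `|u| <= P k) L.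
have near_ok k (L : seq X) : ok k L -> \forall n \near \oo,
    ok k.+1 [seq u + x k n | u <- L] /\ ok k.+1 [seq u - x k n | u <- L].
  elim: L => [_|u L IH /= /andP[uP /IH{}IH]]; first exact: nearW.
  have := xP k (- u); rewrite normrN => /(_ uP) xNu.
  apply: filterS3 IH (xP k u uP) xNu => n [? ?] xu xNu.
  split; apply/andP; split => //; first by rewrite addrC.
  by rewrite -normrN opprB.
have /choice[nn nnP] : forall kL : nat * seq X, exists n, ok kL.1 kL.2 ->
    ok kL.1.+1 [seq u + x kL.1 n | u <- kL.2] /\
    ok kL.1.+1 [seq u - x kL.1 n | u <- kL.2].
  case=> k L /=; have [okL|] := boolP (ok k L); last by exists 0%N.
  by have /near_inftyP[N /(_ N (leqnn N))] := near_ok k L okL; exists N.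
(* [L k] lists all signed sums of the first [k] chosen terms; the index chosen at stage [k] depends
   on this list. *)
pose fix L k := if k is k'.+1 then
  let y := x k' (nn (k', L k')) in
  [seq u + y | u <- L k'] ++ [seq u - y | u <- L k'] else [:: 0].
pose phi k := nn (k, L k).
have okL k : ok k (L k).
  elim: k => [|k IH]; first by rewrite /ok/= normr0 P0.
  by have [? ?] := nnP (k, L k) IH; rewrite /ok /= all_cat; apply/andP.
exists phi => N a a1.
(* Induction on [d]: the first [k] terms carry signs, the next [d] carry arbitrary coefficients in
   [-1, 1]. *)
suff W d k u : u \in L k ->
    `|u + \sum_(k <= i < k + d) a i *: x i (phi i)| <= P (k + d)%N.
  by have := W N 0%N 0; rewrite add0r add0n; apply; rewrite inE.
elim: d k u => [|d IH] k u uL.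
  by rewrite addn0 big_geq// addr0; have /allP/(_ _ uL) := okL k.
rewrite addnS big_ltn ?ltnS ?leq_addr// -addSn addrA addrAC.
apply: norm_segment_le => //.
- rewrite addrAC; apply: IH; rewrite /= mem_cat; apply/orP; left.
  exact: map_f.
- rewrite addrAC; apply: IH; rewrite /= mem_cat; apply/orP; right.
  exact: map_f.
Qed.

Lemma wuc_tail B z a (t : R) m n : wuc B z -> 0 <= t ->
  (forall i, (m <= i)%N -> `|a i| <= t) ->
  `|\sum_(m <= i < n) a i *: z i| <= t * B.
Proof.
move=> zB t0 at_; have B0 := wuc_ge0 zB.
have [t00|tN0] := eqVneq t 0.
  rewrite big_nat big1 ?normr0 ?mulr_ge0// => i /andP[/at_].
  by rewrite t00 normr_le0 => /eqP ->; rewrite scale0r.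
have tp : 0 < t by rewrite lt_def tN0.
have [mn|/ltnW nm] := leqP m n; last by rewrite big_geq// normr0 mulr_ge0.
have -> : \sum_(m <= i < n) a i *: z i =
    t *: \sum_(0 <= i < n) (if (m <= i)%N then a i / t else 0) *: z i.
  rewrite (big_cat_nat (leq0n m) mn)//= [X in X + _]big_nat [X in X + _]big1 ?add0r; last first.
    by move=> i; rewrite ltnNge => /negPf ->; rewrite scale0r.
  rewrite scaler_sumr big_nat [RHS]big_nat; apply: eq_bigr => i /andP[-> _].
  by rewrite scalerA mulrC divfK.
rewrite normrZ ger0_norm// ler_pM2l//; apply: zB => i.
case: ifP => [mi|_]; last by rewrite normr0.
by rewrite normrM normfV (gtr0_norm tp) ler_pdivrMr// mul1r at_.
Qed.

Lemma wuc_norm B z n : wuc B z -> `|z n| <= B.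
Proof.
move=> zB; have := wuc_tail (a := fun=> 1) (t := 1) (m := n) n.+1 zB ler01.
by rewrite big_nat1 scale1r mul1r; apply => *; rewrite normr1.
Qed.

Lemma wuc_shift B z N : wuc B z -> wuc B (fun n => z (n + N)%N).
Proof.
move=> zB K a a1.
have -> : \sum_(0 <= i < K) a i *: z (i + N)%N =
    \sum_(0 + N <= i < K + N) a (i - N)%N *: z i.
  by rewrite big_addn addnK; apply: eq_bigr => i _; rewrite addnK.
by rewrite -[B]mul1r; apply: wuc_tail.
Qed.

Lemma wuc_sub B z i j : wuc B z -> (i < j)%N -> `|z j - z i| <= B.
Proof.
move=> zB ij.
have := zB j.+1 (fun k => if k == j then 1 else if k == i then -1 else 0).
move=> /(_ _)/(le_trans _); apply; last first.
  by move=> k; case: ifP => _; [|case: ifP => _]; rewrite ?normrN ?normr1 ?normr0.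
rewrite big_nat_recr//= eqxx scale1r addrC.
rewrite (eq_big_nat _ _ (F2 := fun k => if k == i then - z i else 0)); last first.
  move=> k /andP[_ kj]; rewrite (ltn_eqF kj); case: ifP => [/eqP ->|_].
    by rewrite scaleN1r.
  by rewrite scale0r.
by rewrite -big_mkcond big_nat1_eq/= ij.
Qed.

Lemma c0_basis_subproof n : (fun i => (i == n)%:R : R^o) \in @c0_pred R.
Proof.
apply/asboolP; apply: cvg_near_cst; apply/near_inftyP; exists n.+1 => i ni.
by rewrite gtn_eqF.
Qed.

Definition c0_basis n : c0 R := C0 (c0_basis_subproof n).

Lemma c0_basis_norm n : 1 <= `|c0_basis n|.
Proof. by apply: le_trans (c0_le_norm _ n); rewrite /c0_basis /= eqxx normr1. Qed.

(** The images of the unit vectors work: combinations of unit vectors with coefficients in [-1, 1]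
    have norm at most 1 in [c0], so [M] bounds their images. *)
Lemma contains_c0_wuc : contains_c0 X ->
  exists z (m B : R), [/\ 0 < m, wuc B z & forall n, m <= `|z n|].
Proof.
move=> [T [m [M [m0 TmM]]]]; exists (T \o c0_basis), m, M; split=> //; last first.
  move=> n /=; have /andP[+ _] := TmM (c0_basis n); apply: le_trans.
  by rewrite ler_peMr ?(ltW m0)// c0_basis_norm.
have M0 : 0 <= M.
  have /andP[h1 h2] := TmM (c0_basis 0).
  have e0 : 0 < `|c0_basis 0| := lt_le_trans ltr01 (c0_basis_norm 0).
  rewrite -(pmulr_lge0 _ e0); apply: le_trans h2; exact: normr_ge0.
move=> N a a1.
have -> : \sum_(0 <= i < N) a i *: (T \o c0_basis) i =
    T (\sum_(0 <= i < N) a i *: c0_basis i).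
  by rewrite linear_sum; apply: eq_bigr => i _; rewrite linearZ.
have /andP[_ /le_trans] := TmM (\sum_(0 <= i < N) a i *: c0_basis i); apply.
rewrite ler_piMr//; apply: c0_norm_le => n.
have -> : (\sum_(0 <= i < N) a i *: c0_basis i : c0 R) n =
    \sum_(0 <= i < N | i == n) a i.
  rewrite [RHS]big_mkcond/=; elim: N => [|N IH]; first by rewrite !big_nil.
  rewrite !big_nat_recr//= -IH.
  change ((\sum_(0 <= i < N) a i *: c0_basis i : c0 R) n + a N * (n == N)%:R =
    (\sum_(0 <= i < N) a i *: c0_basis i : c0 R) n + (if N == n then a N else 0)).
  by congr (_ + _); rewrite eq_sym; case: eqP => _; rewrite ?mulr1 ?mulr0.
by rewrite big_nat1_eq; case: ifP; rewrite ?normr0.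
Qed.

End wuc.

(** * Copies of [c0], and why a positive Opial modulus excludes them *)

Section c0_embedding.
Variables (R : realType) (X : completeNormedModType R).
Implicit Types (z : nat -> X) (B c : R).

(** Far coefficients are at most [e / (B + 1) / 2], so [wuc_tail] makes the partial sums Cauchy; the
    denominator is [B + 1] because [B] may be 0. *)
Lemma wuc_series_cvg B z (a : c0 R) : wuc B z ->
  cvgn (series (fun i => a i *: z i)).
Proof.
move=> zB; have B0 := wuc_ge0 zB.
apply/cauchy_cvgP/cauchy_seriesP => e e0.
have /asboolP/cvgrPdist_le/(_ (e / (B + 1) / 2)) := c0_seqP a.
have d0 : 0 < e / (B + 1) / 2 by rewrite !divr_gt0//; lra.
move=> /(_ d0)/near_inftyP[N aN].
exists ([set n | N <= n]%N, setT) => /=; first by split; [exists N|exact: filterT].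
move=> [m n] /= [Nm _]; apply: (@le_lt_trans _ _ (e / (B + 1) / 2 * B)).
  apply: wuc_tail => //; first exact: ltW.
  by move=> i mi; have := aN i (leq_trans Nm mi); rewrite sub0r normrN.
rewrite -mulrA -mulrA gtr_pMr// mulrA -[ltLHS]mulrAC ltr_pdivrMr ?mul1r; last lra.
by rewrite mulrC ltr_pdivrMr; lra.
Qed.

Lemma wuc_lower c B z (a : nat -> R) (t : R) n N : wuc B z ->
  (forall i, c <= `|z i|) -> 0 <= t -> (forall i, `|a i| <= t) -> (n < N)%N ->
  2 * c * `|a n| - t * B <= `|\sum_(0 <= i < N) a i *: z i|.
Proof.
move=> zB cz t0 at_ nN.
set s := \sum_(0 <= i < N) _.
pose s' := \sum_(0 <= i < N) (if i == n then a i else - a i) *: z i.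
have s's : s + s' = (2 * a n) *: z n.
  rewrite -big_split/= (eq_bigr (fun i => if i == n then (2 * a n) *: z n else 0)).
    by rewrite -big_mkcond big_nat1_eq nN.
  move=> i _; case: eqP => [->|_]; last by rewrite scaleNr subrr.
  by rewrite -scalerDl mulr_natl mulr2n.
have s'B : `|s'| <= t * B.
  by apply: wuc_tail => // i _; case: ifP => _; rewrite ?normrN.
have : `|(2 * a n) *: z n| <= `|s| + `|s'| by rewrite -s's ler_normD.
rewrite normrZ normrM ger0_norm// => h.
have : c * `|a n| <= `|a n| * `|z n| by rewrite mulrC ler_wpM2l.
by lra.
Qed.

(* The lower bound is James' trick: flipping the sign of all terms but the n-th
   turns the sum s into s' with s + s' = 2 a_n z_n and s' bounded by B. *)
Lemma wuc_contains_c0 c B z : wuc B z -> (forall n, c <= `|z n|) -> B < 2 * c ->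
  contains_c0 X.
Proof.
move=> zB cz Bc; have B0 := wuc_ge0 zB.
pose T (a : c0 R) : X := limn (series (fun i => a i *: z i)).
have T_cvg (a : c0 R) : series (fun i => a i *: z i) @ \oo --> T a.
  exact: wuc_series_cvg zB.
have T_lin : linear T.
  move=> k a b; apply/cvg_lim => //.
  rewrite (_ : series _ =
      k *: series (fun i => a i *: z i) + series (fun i => b i *: z i)).
    by apply: cvgD; [apply: cvgZr|]; exact: T_cvg.
  apply/funext => n.
  change (\sum_(0 <= i < n) (k * a i + b i) *: z i =
    k *: (\sum_(0 <= i < n) a i *: z i) + \sum_(0 <= i < n) b i *: z i).
  rewrite scaler_sumr -big_split; apply: eq_bigr => i _ /=.
  by rewrite scalerA -scalerDl.
pose Tl : {linear c0 R -> X} := HB.pack T (GRing.isLinear.Build _ _ _ _ T T_lin).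
exists Tl, (2 * c - B), B; split; first by lra.
move=> a; rewrite /Tl/=.
have Ta : `|series (fun i => a i *: z i) n| @[n --> \oo] --> `|T a|.
  by apply: cvg_norm; exact: T_cvg.
have aa i : `|a i| <= `|a| := c0_le_norm a i.
rewrite -(cvg_lim _ Ta)//; apply/andP; split.
  rewrite mulrBl lerBlDr -ler_pdivlMl; last by lra.
  apply: c0_norm_le => n; rewrite ler_pdivlMl; last by lra.
  rewrite -lerBlDr; apply: limr_ge; first exact: (cvgP _ Ta).
  apply/near_inftyP; exists n.+1 => N nN; rewrite [B * _]mulrC.
  exact: (wuc_lower zB).
apply: limr_le; first exact: (cvgP _ Ta).
by apply: nearW => n; rewrite mulrC; apply: wuc_tail.
Qed.

Lemma opial_gap_sub delta (x : nat -> X) y s : opial_gap X delta ->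
  weak_cvg x 0 -> 0 < s -> s <= `|y| -> (forall n, s <= `|x n|) ->
  forall N, exists2 n, (N <= n)%N & (1 + delta) * s <= `|x n - y|.
Proof.
move=> E x0 s0 sy sx N.
have [|n] := E (fun n => x (n + N)%N) y s _ s0 sy (fun n => sx _).
  by apply: (@weak_cvg_subseq _ _ _ _ (addn^~ N)) x0 => n; exact: leq_addr.
by exists (n + N)%N => //; exact: leq_addl.
Qed.

(** The pairs span consecutive disjoint blocks, so the sum unfolds to one with coefficients [- a k]
    at [p k], [a k] at [q k] and 0 in between. *)
Lemma wuc_diff B z (p q : nat -> nat) : wuc B z ->
  (forall k, (p k < q k)%N /\ p k.+1 = (q k).+1) ->
  wuc B (fun k => z (q k) - z (p k)).
Proof.
move=> zB pq N a a1.
have [b b1 ->] : exists2 b : nat -> R, (forall i, `|b i| <= 1) &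
    \sum_(0 <= k < N) a k *: (z (q k) - z (p k)) = \sum_(0 <= i < p N) b i *: z i;
  last exact: zB.
elim: N => [|N [b b1 bE]].
  exists (fun=> 0); first by move=> i; rewrite normr0.
  by rewrite big_nil big1// => i _; rewrite scale0r.
have [pqN pN] := pq N.
exists (fun i => if (i < p N)%N then b i else if i == p N then - a N
  else if i == q N then a N else 0).
  move=> i; case: ifP => _; first exact: b1.
  case: ifP => _; first by rewrite normrN.
  by case: ifP => _; rewrite ?normr0 ?ler01.
rewrite big_nat_recr//= bE pN big_nat_recr//.
rewrite (big_cat_nat (leq0n (p N)) (ltnW pqN))/= (big_ltn pqN).
rewrite ltnn eqxx [in RHS]ltnNge (ltnW pqN)/= (gtn_eqF pqN) eqxx.
rewrite [X in _ = _ + (_ + X) + _]big_nat [X in _ = _ + (_ + X) + _]big1; last first.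
  move=> i /andP[pi iq]; rewrite ltnNge (ltnW pi)/= (gtn_eqF pi) (ltn_eqF iq).
  by rewrite scale0r.
rewrite addr0 -addrA [X in _ + X = _]scalerBr scaleNr [_ - a N *: _]addrC; congr (_ + _).
by apply: eq_big_nat => i /andP[_ ->].
Qed.

(** The weakly null [z] is tested against its own members: each [z i] has a later [z n] at distance
    at least [(1 + delta) * s]. Differences over disjoint pairs keep the constant [B]. *)
Lemma opial_gap_wuc_grow delta B z (s : R) : opial_gap X delta -> wuc B z ->
  0 < s -> (forall n, s <= `|z n|) ->
  exists2 z' : nat -> X, wuc B z' & forall n, (1 + delta) * s <= `|z' n|.
Proof.
move=> E zB s0 sz.
have /choice[g gP] : forall i, exists n, (i < n)%N /\ (1 + delta) * s <= `|z n - z i|.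
  move=> i; have [n ? ?] := opial_gap_sub E (wuc_weak_cvg0 zB) s0 (sz i) sz i.+1.
  by exists n.
pose p k := iter k (fun i => (g i).+1) 0%N.
exists (fun k => z (g (p k)) - z (p k)); last by move=> k; have [] := gP (p k).
by apply: (@wuc_diff B z p (g \o p)) => // k; split => //; have [] := gP (p k).
Qed.

(** Iterating the growth step gives lower bounds [(1 + delta) ^+ k * m], which exceed [B] by
    Bernoulli's inequality, while [B] bounds every single term. *)
Lemma opial_gap_no_wuc delta B z (m : R) : 0 < delta -> opial_gap X delta ->
  wuc B z -> 0 < m -> ~ (forall n, m <= `|z n|).
Proof.
move=> d0 E zB m0 mz.
have grow k : exists2 z' : nat -> X, wuc B z' & forall n, (1 + delta) ^+ k * m <= `|z' n|.
  elim: k => [|k [z' z'B z'm]]; first by exists z => // n; rewrite expr0 mul1r.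
  have [||z'' ? ?] := opial_gap_wuc_grow E z'B (s := (1 + delta) ^+ k * m).
  - by rewrite mulr_gt0// exprn_gt0//; lra.
  - exact: z'm.
  - by exists z'' => // n; rewrite exprS -mulrA.
have B0 := wuc_ge0 zB.
have [k kB] : exists k, B < k%:R * (delta * m).
  exists (Num.bound (B / (delta * m))); rewrite -ltr_pdivrMr ?mulr_gt0//.
  by rewrite archi_boundP// divr_ge0// ltW// mulr_gt0.
have [z' z'B /(_ 0%N) z'm] := grow k.
have := le_trans z'm (wuc_norm 0 z'B); apply/negP; rewrite -ltNge.
apply: lt_le_trans kB _; rewrite mulrA ler_pM2r//.
have H : 1 + k%:R * delta <= (1 + delta) ^+ k.
  elim: k {z'm} => [|k IH]; first by rewrite mul0r addr0 expr0.
  rewrite exprS -natr1; apply: (@le_trans _ _ ((1 + delta) * (1 + k%:R * delta))).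
    by have := ler0n R k; nra.
  by rewrite ler_pM2l//; lra.
by lra.
Qed.

End c0_embedding.

(** * Conditions (a), (c) and (d) compared with (e) *)

Section property_M_consequences.
Variables (R : realType) (X : completeNormedModType R).
Hypothesis MX : property_M X.
Implicit Types (x y z : nat -> X) (B c : R).

(** Property (M) passes from the one vector [- y], of norm at least 1, to the whole unit ball;
    scaling by [1 - eta] then leaves room below 1. *)
Lemma opial_modulus_flat : ~ (0 < opial_modulus X 1)%E ->
  forall eta : R, 0 < eta < 1 -> exists x, [/\ weak_cvg x 0,
    forall n, 1 - eta <= `|x n| &
    forall u, `|u| <= 1 - eta -> \forall n \near \oo, `|x n + u| <= 1 - eta / 2].
Proof.
move=> r0 eta /andP[e0 e1].
(* The excess [eta / 8] becomes [eta / 4] under (M), and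
   [(1 - eta) * (1 + eta / 4) <= 1 - eta / 2]. *)
have [|x [y [x0 y1 x1 xy]]] := opial_modulus_witness r0 (eps := eta / 8); first lra.
have s0 : 0 < 1 - eta by lra.
have nS u : `|(1 - eta) *: u| = (1 - eta) * `|u| by rewrite normrZ gtr0_norm.
exists (fun n => (1 - eta) *: x n); split; first exact: weak_cvgZ0.
  by move=> n; rewrite nS ler_peMr// ltW.
move=> u us; have : \forall n \near \oo, `|x n + (1 - eta)^-1 *: u| <= 1 + eta / 4.
  apply: (property_M_near (v := - y) (c := 1 + eta / 8) MX x0); last by lra.
    rewrite normrN normrZ gtr0_norm ?invr_gt0// mulrC ler_pdivrMr//.
    by apply: le_trans us _; rewrite ler_peMl// ltW.
  exact: nearW.
apply: filterS => n xn.
have -> : (1 - eta) *: x n + u = (1 - eta) *: (x n + (1 - eta)^-1 *: u).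
  by rewrite scalerDr scalerA divff ?scale1r// gt_eqF.
by rewrite nS; nra.
Qed.

(** The flat sequence for [eta k = 2^-(k+1)] enlarges the radius [1 - eta k] exactly to
    [1 - eta k.+1], as [wuc_build] requires; the term chosen at stage [k] has norm at least
    [1 - eta k]. *)
Lemma opial_modulus_wuc : ~ (0 < opial_modulus X 1)%E ->
  exists y : nat -> X, wuc 1 y /\
    forall e : R, 0 < e -> \forall n \near \oo, 1 - e <= `|y n|.
Proof.
move=> r0; pose eta k : R := 2^-1 ^+ k.+1.
have eta0 k : 0 < eta k by rewrite exprn_gt0.
have etaS k : eta k.+1 = eta k / 2 by rewrite /eta exprSr.
have eta1 k : eta k < 1 by rewrite exprn_ilt1//; lra.
have /choice[x xP] : forall k, exists x, [/\ weak_cvg x 0,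
    forall n, 1 - eta k <= `|x n| &
    forall u, `|u| <= 1 - eta k -> \forall n \near \oo, `|x n + u| <= 1 - eta k / 2].
  by move=> k; apply: opial_modulus_flat => //; rewrite eta0 eta1.
have [||phi phiP] := @wuc_build _ _ (fun k => 1 - eta k) x.
- by have := eta1 0%N; lra.
- by move=> k u; rewrite etaS; have [_ _] := xP k; exact.
exists (fun k => x k (phi k)); split.
  by move=> N a /(phiP N)/le_trans; apply; have := eta0 N; lra.
move=> e e0.
have : eta @ \oo --> 0.
  rewrite (_ : eta = geometric 2^-1 2^-1); last first.
    by apply/funext => k; rewrite /eta /= exprS.
  by apply: cvg_geometric; rewrite ger0_norm; lra.
move=> /cvgr0_norm_le/(_ e e0); apply: filterS => n.
rewrite ger0_norm ?(ltW (eta0 n))// => ?.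
by have [_ /(_ (phi n))] := xP n; lra.
Qed.

Lemma wuc_norm_cvg1 y : wuc 1 y ->
  (forall e : R, 0 < e -> \forall n \near \oo, 1 - e <= `|y n|) ->
  `|y n| @[n --> \oo] --> (1 : R).
Proof.
move=> y1 y2; apply/cvgrPdist_le => e /y2; apply: filterS => n yn.
by have := wuc_norm n y1; rewrite ler_norml; lra.
Qed.

Lemma no_c0_opial : ~ contains_c0 X -> (0 < opial_modulus X 1)%E.
Proof.
apply: contra_notP => /opial_modulus_wuc[y [y1 y2]].
have /near_inftyP[N yN] := y2 4^-1 ltac:(lra).
apply: (wuc_contains_c0 (wuc_shift N y1) (c := 3 / 4)); last lra.
by move=> n; have := yN (n + N)%N (leq_addl _ _); lra.
Qed.

Lemma opial_no_c0 : (0 < opial_modulus X 1)%E -> ~ contains_c0 X.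
Proof.
move=> /opial_modulus_gap[delta /andP[d0 _] E] /contains_c0_wuc[z [m [B [m0 zB mz]]]].
exact: opial_gap_no_wuc d0 E zB m0 mz.
Qed.

(** For [n > j] the bound on signed sums gives [|y n - y j| <= 1], so (c) would force
    [|y j| <= K < 1] for every [j], against [|y j|] tending to 1. *)
Lemma property_K_opial : property_K X -> (0 < opial_modulus X 1)%E.
Proof.
move=> [_ [K /andP[K0 K1] KX]]; apply: contrapT => /opial_modulus_wuc[y [y1 y2]].
have yK j : `|y j| <= K.
  apply: (KX y); [exact: wuc_weak_cvg0 y1|exact: wuc_norm_cvg1|].
  apply: le_trans (limn_einf_sup _) _; apply: limn_esup_le.
  by apply/near_inftyP; exists j.+1 => n jn; rewrite lee_fin (wuc_sub y1).
have /near_inftyP[N /(_ N (leqnn N))] := y2 ((1 - K) / 2) ltac:(lra).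
by have := yK N; lra.
Qed.

Lemma opial_property_K : ~ schur X -> (0 < opial_modulus X 1)%E -> property_K X.
Proof.
move=> nS /opial_modulus_gap[delta /andP[d0 d1] E]; split => //.
(* As [0 < delta <= 1], [(1 + delta) * (1 - delta / 4)] exceeds [1 + delta / 4], so the gap at level
   [1 - delta / 4] excludes any [y] of larger norm. *)
exists (1 - delta / 4); first by apply/andP; split; lra.
move=> x y x0 x1 xy; rewrite leNgt; apply/negP => yK.
have /near_inftyP[N xN] := cvgr_ge _ x1 (1 - delta / 4) ltac:(lra).
have xyd : (limn_einf (fun n => `|x n - y|%:E) < (1 + delta / 4)%:E)%E.
  by apply: le_lt_trans xy _; rewrite lte_fin; lra.
have [phi phin phix] := frequently_subseq (limn_einf_lt xyd).
pose psi n := phi (n + N)%N.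
have psin n : (n <= psi n)%N by apply: leq_trans (phin _); exact: leq_addr.
have xs n : 1 - delta / 4 <= `|(x \o psi) n|.
  by apply: xN; apply: leq_trans (phin _); exact: leq_addl.
have s0 : 0 < 1 - delta / 4 by lra.
have [n] := E _ _ _ (weak_cvg_subseq psin x0) s0 (ltW yK) xs.
by have := phix (n + N)%N; rewrite lte_fin /= /psi; nra.
Qed.

(** The sequence [y n + e] tends weakly to the unit vector [e] with norms tending to 1, but not in
    norm. The upper bounds come from (M), which compares a multiple of [e] with some [- y j], where
    [|y n - y j| <= 1]. *)
Lemma kadec_klee_opial : kadec_klee X -> (0 < opial_modulus X 1)%E.
Proof.
move=> KK; apply: contrapT => /opial_modulus_wuc[y [y1 y2]].
have y0 : weak_cvg y 0 := wuc_weak_cvg0 y1.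
have /near_inftyP[J /(_ J (leqnn J)) yJ] := y2 2^-1 ltac:(lra).
have yJ0 : 0 < `|y J| by lra.
pose e := `|y J|^-1 *: y J.
have e1 : `|e| = 1 by rewrite normrZ normfV normr_id mulVf// gt_eqF.
have near_le (u : X) (eta : R) : `|u| = 1 -> 0 < eta ->
    \forall n \near \oo, `|y n + u| <= 1 + 2 * eta.
  move=> u1 eta0; have /near_inftyP[j /(_ j (leqnn j)) yj] := y2 eta eta0.
  have uj : `|(`|y j| *: u)| <= `|- y j| by rewrite normrZ u1 mulr1 normr_id normrN.
  have yj1 := wuc_norm j y1.
  have : \forall n \near \oo, `|y n + `|y j| *: u| <= 1 + eta.
    apply: (property_M_near (c := 1) MX y0 uj); last lra.
    by apply/near_inftyP; exists j.+1 => n jn; exact: wuc_sub y1 jn.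
  apply: filterS => n yn.
  have -> : y n + u = (y n + `|y j| *: u) + (1 - `|y j|) *: u.
    by rewrite -addrA -scalerDl subrKC scale1r.
  apply: le_trans (ler_normD _ _) _; rewrite [`|_ *: u|]normrZ u1 mulr1 ger0_norm; lra.
have ye : `|y n + e| @[n --> \oo] --> `|e|.
  rewrite e1; apply/cvgrPdist_le => eta eta0.
  have := near_le e (eta / 2) e1 _; have := near_le (- e) (eta / 2) _ _.
  rewrite normrN => /(_ e1) H1 H2.
  have eta2 : 0 < eta / 2 by lra.
  apply: filterS2 (H1 eta2) (H2 eta2) => n h1 h2.
  (* The upper bound for [y n - e] yields the lower bound for [y n + e], since both norms add up to
     at least 2. *)
  have : `|e + e| <= `|y n + e| + `|y n - e|.
    have -> : e + e = (y n + e) - (y n - e) by rewrite opprD opprK addrACA subrr add0r.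
    exact: ler_normB.
  rewrite -mulr2n normrMn e1 ler_norml; lra.
have ywe : weak_cvg (fun n => y n + e) e by have := weak_cvgDr (u := e) y0; rewrite add0r.
have yle : \forall n \near \oo, `|y n + e - e| <= 4^-1.
  exact: cvgr_le _ (KK _ _ ywe ye) 4^-1 ltac:(lra).
have /near_inftyP[N /(_ N (leqnn N))] := filterI yle (y2 2^-1 ltac:(lra)).
by move=> -[/=]; rewrite addrK; lra.
Qed.

(** If [x n - y] stays away from 0 along a subsequence, (M) allows a choice of its terms whose
    signed sums stay in the balls of radius [|y| + 1 - 2^-k]; the gap excludes this. *)
Lemma opial_kadec_klee : (0 < opial_modulus X 1)%E -> kadec_klee X.
Proof.
move=> /opial_modulus_gap[delta /andP[d0 _] E] x y xy nxy.
have D0 := weak_cvgB0 xy; set D := fun n => x n - y in D0.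
apply: contrapT => nD.
have [eps e0 De] : exists2 eps : R, 0 < eps &
    forall N, exists2 n, (N <= n)%N & eps <= `|D n|.
  apply: contrapT => H; apply: nD; apply/cvgrPdist_lt => e e0.
  apply/near_inftyP; apply: contrapT => H2; apply: H; exists e => // N.
  apply: contrapT => H3; apply: H2; exists N => n Nn.
  rewrite sub0r normrN normr_id ltNge; apply/negP => ?.
  by apply: H3; exists n.
have [phi phin phiD] := frequently_subseq De.
have z0 : weak_cvg (D \o phi) 0 := weak_cvg_subseq phin D0.
have zy : `|(D \o phi) n + y| @[n --> \oo] --> `|y|.
  rewrite (_ : (fun n => _) = (fun n => `|x n|) \o phi); last first.
    by apply/funext => n; rewrite /= /D subrK.
  exact: (cvg_comp _ _ (ge_id_cvg_infty phin) nxy).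
(* Adding a far term to a vector in the ball of radius [t] costs at most [d]. A vector [u] longer
   than [y] is shrunk to [w] of norm [|y|], and the excess [|u| - |y|] is added back. *)
have near_le (u : X) (t d : R) : `|y| <= t -> 0 < d -> `|u| <= t ->
    \forall n \near \oo, `|(D \o phi) n + u| <= t + d.
  move=> yt d0' ut.
  have y_le : \forall n \near \oo, `|(D \o phi) n + y| <= `|y| + d / 2.
    by apply: cvgr_le zy _ _; lra.
  have d2 : `|y| + d / 2 < `|y| + d by lra.
  have [uy|yu] := leP `|u| `|y|.
    apply: filterS (property_M_near MX z0 uy y_le d2) => n /le_trans; apply.
    by rewrite lerD2r.
  have u0 : 0 < `|u| := le_lt_trans (normr_ge0 _) yu.
  pose w := (`|y| / `|u|) *: u.
  have wy : `|w| <= `|y|.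
    by rewrite normrZ normrM normfV !normr_id divfK// gt_eqF.
  have uw : `|u - w| <= `|u| - `|y|.
    rewrite -[X in X - _]scale1r -scalerBl normrZ ger0_norm; last first.
      by rewrite subr_ge0 ler_pdivrMr// mul1r ltW.
    by rewrite mulrBl mul1r divfK// gt_eqF.
  apply: filterS (property_M_near MX z0 wy y_le d2) => n zw; rewrite -[u](subrK w) addrCA.
  by apply: le_trans (ler_normD _ _) _; lra.
pose P k : R := `|y| + 1 - 2^-1 ^+ k.
have [||psi psiP] := @wuc_build _ _ P (fun=> D \o phi).
- by rewrite /P expr0 addrK.
- move=> k u uP.
  have -> : P k.+1 = P k + 2^-1 ^+ k.+1 by rewrite /P exprS; lra.
  have Pk : `|y| <= P k by rewrite /P -addrA lerDl subr_ge0 exprn_ile1//; lra.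
  have k0 : (0 : R) < 2^-1 ^+ k.+1 by rewrite exprn_gt0.
  exact: near_le Pk k0 uP.
apply: (opial_gap_no_wuc d0 E (B := `|y| + 1) _ e0 (fun n => phiD (psi n))).
move=> N a /(psiP N)/le_trans; apply; rewrite /P.
by have : 0 < 2^-1 ^+ N :> R; [rewrite exprn_gt0|lra].
Qed.

End property_M_consequences.

(** * The compact simplex of nonnegative sequences with sum at most 1 *)

Section simplex.
Variables (R : realType).

(** The sum is at most 1 rather than equal to 1, so that the set is closed under coordinatewise
    limits; the missing weight sits on the point 0 of the hull. *)
Definition simplex : set {ptws nat -> R} :=
  [set a | (forall i, 0 <= a i) /\ forall N, \sum_(0 <= i < N) a i <= 1].

Lemma ptws_eval_continuous i : continuous (fun a : {ptws nat -> R} => a i).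
Proof. exact: (@proj_continuous nat (fun=> R) i). Qed.

Lemma ptws_sum_continuous (w : nat -> R) N :
  continuous (fun a : {ptws nat -> R} => \sum_(0 <= i < N) a i * w i).
Proof.
apply: continuous_big => [|i _ a]; first exact: add_continuous.
have aw := cvgM (@ptws_eval_continuous i a) (cvg_cst (w i)).
exact: aw.
Qed.

Lemma simplex_le1 a : simplex a -> forall i, 0 <= a i <= 1.
Proof.
move=> [a0 a1] i; rewrite a0/=; apply: le_trans (a1 i.+1).
by rewrite big_nat_recr//= lerDr sumr_ge0.
Qed.

Lemma simplex_tail a m n : simplex a -> \sum_(m <= i < n) a i <= 1.
Proof.
move=> [a0 a1]; have [mn|/ltnW nm] := leqP m n; last by rewrite big_geq.
apply: le_trans (a1 n); rewrite (big_cat_nat (leq0n m) mn)/= lerDr.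
by rewrite sumr_ge0.
Qed.

Lemma simplex_compact : compact simplex.
Proof.
have cube : compact [set a : {ptws nat -> R} | forall i : nat, `[0, 1]%classic (a i)].
  exact: (tychonoff (fun=> @segment_compact R 0 1)).
apply: (subclosed_compact _ cube); last first.
  by move=> a Sa i; rewrite /= in_itv/=; exact: simplex_le1.
rewrite (_ : simplex = \bigcap_i ((fun a : {ptws nat -> R} => a i) @^-1` [set t | 0 <= t])
    `&` \bigcap_N ((fun a : {ptws nat -> R} => \sum_(0 <= i < N) a i * 1)
      @^-1` [set t | t <= 1])); last first.
  apply/seteqP; split => a.
    move=> [a0 a1]; split => [i _|N _]; first exact: a0.
    by rewrite /preimage/=; under eq_bigr do rewrite mulr1; exact: a1.
  move=> [a0 a1]; split => [i|N]; first exact: a0.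
  by have := a1 N I; rewrite /preimage/=; under eq_bigr do rewrite mulr1.
apply: closedI; apply: closed_bigI => i _.
  apply: closed_comp; last exact: closed_ge.
  by move=> a _; exact: ptws_eval_continuous.
apply: closed_comp; last exact: closed_le.
by move=> a _; exact: (@ptws_sum_continuous (fun=> 1)).
Qed.

End simplex.

(** * Weak convergence of filters, for continuity into the weak topology and weak neighbourhoods *)

Section weak_filter.
Variables (R : realType) (X : normedModType R).

Lemma weak_topology_cvgP (F : set_system X) (y : X) : Filter F ->
  (F --> (y : weak_topology X)) <->
  forall f : {linear X -> R^o}, continuous f -> f x @[x --> F] --> f y.
Proof.
move=> FF; split=> [Fy f cf|Fy].
  have /cvg_sup/(_ (exist _ f cf)) Fyf := Fy.
  exact: (cvg_comp _ _ Fyf (@initial_continuous _ _ _ y)).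
apply/cvg_sup => -[f cf] A /=.
rewrite (@nbhsE (initial_topology (f : X -> R^o))) => -[_ [[B Bo <-] Bfy] BA].
by apply: filterS BA _; exact: (Fy f cf B (open_nbhs_nbhs (conj Bo Bfy))).
Qed.

End weak_filter.

(** * The closed convex hull of 0 and a weakly unconditionally Cauchy sequence; (b) implies (e) *)

Section simplex_hull.
Variables (R : realType) (X : completeNormedModType R).
Variables (y : nat -> X) (y1 : wuc 1 y).
Implicit Types a b : {ptws nat -> R}.

Definition hull_point a : X := limn (series (fun i => a i *: y i)).

Definition simplex_hull : set X := hull_point @` @simplex R.

Lemma hull_point_cvg a : simplex a ->
  series (fun i => a i *: y i) @ \oo --> hull_point a.
Proof.
move=> Sa; apply: normed_cvg; change (cvgn (series (fun i => `|a i *: y i|))).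
apply: nondecreasing_is_cvgn; first by apply: nondecreasing_series => *.
exists 1 => _ [N _ <-]; apply: le_trans (Sa.2 N).
rewrite /series/=; apply: ler_sum => i _; have /andP[a0 _] := simplex_le1 Sa i.
by rewrite normrZ ger0_norm// ler_piMr// (wuc_norm _ y1).
Qed.

Lemma hull_point_functional (f : {linear X -> R^o}) a : continuous f ->
  simplex a -> \sum_(0 <= i < N) a i * f (y i) @[N --> \oo] --> f (hull_point a).
Proof.
move=> cf Sa.
rewrite (_ : (fun N => \sum_(0 <= i < N) _) = f \o series (fun i => a i *: y i)).
  exact: (cvg_comp _ _ (hull_point_cvg Sa) (cf (hull_point a))).
apply/funext => N; rewrite /series/= linear_sum.
by apply: eq_bigr => i _; rewrite linearZ.
Qed.

Lemma hull_point_tail (f : {linear X -> R^o}) a (e : R) N : continuous f ->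
  simplex a -> (forall i, (N <= i)%N -> `|f (y i)| <= e) ->
  `|f (hull_point a) - \sum_(0 <= i < N) a i * f (y i)| <= e.
Proof.
move=> cf Sa fe; have e0 : 0 <= e := le_trans (normr_ge0 _) (fe N (leqnn N)).
have H : `|\sum_(0 <= i < M) a i * f (y i) - \sum_(0 <= i < N) a i * f (y i)|
    @[M --> \oo] --> `|f (hull_point a) - \sum_(0 <= i < N) a i * f (y i)|.
  apply: (@cvg_norm _ R^o); apply: (@cvgB _ R^o); last exact: cvg_cst.
  exact: hull_point_functional.
rewrite -(cvg_lim _ H)//; apply: limr_le; first exact: (cvgP _ H).
apply/near_inftyP; exists N => M NM.
rewrite (big_cat_nat (leq0n N) NM)/= addrC addrK.
apply: le_trans (ler_norm_sum _ _ _) _.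
apply: (@le_trans _ _ (\sum_(N <= i < M) a i * e)).
  rewrite big_nat [leRHS]big_nat; apply: ler_sum => i /andP[Ni _].
  have /andP[a0 _] := simplex_le1 Sa i.
  by rewrite normrM ger0_norm// ler_wpM2l// fe.
by rewrite -mulr_suml ler_piMl// simplex_tail.
Qed.

(** As [f (y i)] tends to 0 and the weights add up to at most 1, finite sums approximate
    [f (hull_point a)] uniformly in [a]. Hence [hull_point] is weakly continuous on the compact
    simplex. *)
Lemma simplex_hull_compact : compact (simplex_hull : set (weak_topology X)).
Proof.
apply: (@continuous_compact {ptws nat -> R} (weak_topology X)); last exact: simplex_compact.
apply/subspace_continuousP => a Sa.
apply/weak_topology_cvgP => f cf.
apply/cvgrPdist_le => e e0.
have /weak_cvgP/(_ f cf) := wuc_weak_cvg0 y1; rewrite linear0 => fy0.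
have /near_inftyP[N fN] := cvgr0_norm_le _ fy0 (e / 3) ltac:(lra).
have Sb : \forall b \near within (@simplex R) (nbhs a), simplex b.
  exact: withinT.
have /(cvg_within_filter (@simplex R))/cvgrPdist_le/(_ (e / 3) ltac:(lra)) ab :=
  @ptws_sum_continuous _ (fun i => f (y i)) N a.
apply: filterS2 Sb ab => b Sb; rewrite /= !ler_norml => ab.
have := hull_point_tail cf Sa fN; have := hull_point_tail cf Sb fN.
by rewrite !ler_norml; lra.
Qed.

Lemma simplex_hull_convex : convex_set simplex_hull.
Proof.
move=> _ _ t /set_mem[a Sa <-] /set_mem[b Sb <-]; apply/mem_set.
have /andP[t0 t1] : 0 <= t%:num <= 1 by rewrite ge0 le1.
have Sc : simplex (fun i => t%:num * a i + (1 - t%:num) * b i : R).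
  split=> [i|N].
    have /andP[a0 _] := simplex_le1 Sa i; have /andP[b0 _] := simplex_le1 Sb i.
    by rewrite addr_ge0// mulr_ge0// subr_ge0.
  rewrite big_split/= -!mulr_sumr.
  by have := Sa.2 N; have := Sb.2 N; nra.
exists (fun i => t%:num * a i + (1 - t%:num) * b i) => //.
apply/cvg_lim => //.
rewrite (_ : series _ = t%:num *: series (fun i => a i *: y i) +
    (1 - t%:num) *: series (fun i => b i *: y i)).
  by apply: cvgD; apply: cvgZr; exact: hull_point_cvg.
apply/funext => n.
change (\sum_(0 <= i < n) (t%:num * a i + (1 - t%:num) * b i) *: y i =
  t%:num *: (\sum_(0 <= i < n) a i *: y i) +
  (1 - t%:num) *: \sum_(0 <= i < n) b i *: y i).
rewrite !scaler_sumr -big_split; apply: eq_bigr => i _ /=.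
by rewrite !scalerA -scalerDl.
Qed.

(** Differences of members of the simplex have coordinates in [-1, 1]. *)
Lemma simplex_hull_diam : (diam simplex_hull <= 1)%E.
Proof.
apply: ge_ereal_sup => _ [[_ _] [/= [a Sa <-] [b Sb <-]] <-]; rewrite lee_fin.
have H : `|series (fun i => a i *: y i) N - series (fun i => b i *: y i) N|
    @[N --> \oo] --> `|hull_point a - hull_point b|.
  by apply: cvg_norm; apply: cvgB; exact: hull_point_cvg.
rewrite -(cvg_lim _ H)//; apply: limr_le; first exact: (cvgP _ H).
apply: nearW => N; rewrite /series/= -sumrB.
under eq_bigr do rewrite -scalerBl.
apply: y1 => i; have := simplex_le1 Sa i; have := simplex_le1 Sb i.
by rewrite ler_norml; lra.
Qed.

Lemma simplex_hull_mem k : simplex_hull (y k).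
Proof.
exists (fun i => (i == k)%:R).
  split=> [i|N]; first by rewrite ler0n.
  rewrite (eq_bigr (fun i => if i == k then 1 else 0)); last by move=> i _; case: eqP.
  by rewrite -big_mkcond big_nat1_eq; case: ifP.
apply/cvg_lim => //; apply: cvg_near_cst; apply/near_inftyP; exists k.+1 => N kN.
rewrite /series/= (eq_bigr (fun i => if i == k then y k else 0)).
  by rewrite -big_mkcond big_nat1_eq kN.
by move=> i _; case: eqP => [->|_]; rewrite ?scale1r ?scale0r.
Qed.

Lemma simplex_hull0 : simplex_hull 0.
Proof.
exists (fun=> 0); first by split => // N; rewrite big1.
apply/cvg_lim => //; apply: cvg_near_cst; apply: nearW => N.
by rewrite /series/= big1// => i _; rewrite scale0r.
Qed.

End simplex_hull.

(** A point [x0] of the hull with [|x0 - y n| <= r < 1] for all [n] would, by (M) applied to 0 and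
    [- x0], keep [|y n|] eventually at most [(1 + r) / 2], against [|y n|] tending to 1. *)
Lemma weak_normal_structure_opial (R : realType) (X : completeNormedModType R) :
  property_M X -> weak_normal_structure X -> (0 < opial_modulus X 1)%E.
Proof.
move=> MX WNS; apply: contrapT => /(opial_modulus_wuc MX)[y [y1 y2]].
have [|x0 Cx0 x0diam] := WNS _ (simplex_hull_compact y1) (simplex_hull_convex y1).
  have /near_inftyP[J /(_ J (leqnn J)) yJ] := y2 2^-1 ltac:(lra).
  exists (y J), 0; split; [exact: simplex_hull_mem|exact: simplex_hull0|].
  by rewrite -normr_gt0; lra.
have {x0diam} := lt_le_trans x0diam (simplex_hull_diam y1).
set s := ereal_sup _ => s1.
have x0s k : (`|x0 - y k|%:E <= s)%E.
  by apply: ereal_sup_ubound; exists (y k) => //; exact: simplex_hull_mem.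
case: s s1 x0s => [r| |] //; last by move=> _ /(_ 0%N).
rewrite lte_fin => r1 x0r.
have : \forall n \near \oo, `|y n + 0| <= (1 + r) / 2.
  apply: (property_M_near (v := - x0) (c := r) MX (wuc_weak_cvg0 y1)).
  - by rewrite normr0.
  - by apply: nearW => n; have := x0r n; rewrite lee_fin distrC.
  - by lra.
have /filterI := y2 ((1 - r) / 4) ltac:(lra).
move=> /[apply] /near_inftyP[N /(_ N (leqnn N))] [].
by rewrite addr0; lra.
Qed.

(** * The Hahn-Banach theorem for sublinear functionals *)

Section hahn_banach.
Variables (R : realType) (X : lmodType R).
Implicit Types (p q f g : X -> R) (x y z : X).

Definition sublinear p := (forall x y, p (x + y) <= p x + p y) /\
  forall (c : R) x, 0 < c -> p (c *: x) = c * p x.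

Lemma sublinear0 p : sublinear p -> p 0 = 0.
Proof. by move=> [_ /(_ 2 0 ltac:(lra))]; rewrite scaler0; lra. Qed.

Lemma sublinearN p x : sublinear p -> - p (- x) <= p x.
Proof.
by move=> sp; have := sp.1 x (- x); rewrite subrr (sublinear0 sp); lra.
Qed.

(** The functional is the pointwise infimum, kept finite by [l]. Each inequality may be witnessed by
    another member of [F], which covers both the shifts of one functional and chains ordered
    pointwise. *)
Lemma inf_sublinear (F : set (X -> R)) (l : X -> R) : F !=set0 ->
  (forall f x, F f -> l x <= f x) ->
  (forall f g x y, F f -> F g -> exists2 h, F h & h (x + y) <= f x + g y) ->
  (forall f (c : R) x, F f -> 0 < c -> exists2 h, F h & h (c *: x) <= c * f x) ->
  exists2 q, sublinear q & forall f x, F f -> q x <= f x.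
Proof.
move=> [f0 Ff0] lF FD FZ; pose q x := inf [set f x | f in F].
have qF f x : F f -> q x <= f x.
  move=> Ff; apply: ge_inf; last by exists f.
  by exists (l x) => _ [g Fg <-]; exact: lF.
have q_ge x (r : R) : (forall f, F f -> r <= f x) -> r <= q x.
  move=> rF; apply: lb_le_inf; first by exists (f0 x), f0.
  by move=> _ [f Ff <-]; exact: rF.
have qZ (c : R) x : 0 < c -> q (c *: x) <= c * q x.
  move=> c0; rewrite -ler_pdivrMl//; apply: (q_ge x) => f Ff.
  rewrite ler_pdivrMl//; have [h Fh] := FZ f c x Ff c0.
  by apply: le_trans; exact: qF.
exists q => //; split=> [x y|c x c0].
  rewrite -lerBlDr; apply: (q_ge x) => f Ff; rewrite lerBlDr -lerBlDl.
  apply: (q_ge y) => g Fg; rewrite lerBlDl.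
  by have [h Fh] := FD f g x y Ff Fg; apply: le_trans; exact: qF.
apply/le_anti; rewrite qZ//= -ler_pdivlMl//.
have ci0 : 0 < c^-1 by rewrite invr_gt0.
by have := qZ _ (c *: x) ci0; rewrite scalerA mulVf ?scale1r ?gt_eqF.
Qed.

(** The functional is the infimum of [p (x + t *: y) - t * p y] over [t >= 0]: [t = 0] gives
    [q <= p], and [t = 1] the bound at [- y]. *)
Lemma sublinear_shift p y : sublinear p -> exists q, [/\ sublinear q,
  forall x, q x <= p x & q (- y) <= - p y].
Proof.
move=> sp; have [pD pZ] := sp; have p0 := sublinear0 sp.
have pZ0 (t : R) x : 0 <= t -> p (t *: x) = t * p x.
  rewrite le_eqVlt => /predU1P[<-|]; last exact: pZ.
  by rewrite scale0r mul0r.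
pose h (t : R) x := p (x + t *: y) - t * p y.
have [||||q sq qh] := @inf_sublinear [set h t | t in [set t : R | 0 <= t]]
    (fun x => - p (- x)).
- by exists (h 0), 0 => /=.
- move=> _ x [t /= t0 <-]; rewrite /h; have := pD (x + t *: y) (- x).
  by rewrite addrAC subrr add0r pZ0//; lra.
- move=> _ _ x z [s /= s0 <-] [t /= t0 <-].
  exists (h (s + t)); first by exists (s + t) => //=; rewrite addr_ge0.
  rewrite /h scalerDl addrACA.
  by have := pD (x + s *: y) (z + t *: y); lra.
- move=> _ c x [t /= t0 <-] c0.
  exists (h (c * t)); first by exists (c * t) => //=; rewrite mulr_ge0// ltW.
  by rewrite /h -scalerA -scalerDr pZ// mulrBr mulrA.
exists q; split => // [x|].
  have := qh (h 0) x (ex_intro2 _ _ 0 (lexx 0) erefl).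
  by rewrite /h scale0r addr0 mul0r subr0.
have := qh (h 1) (- y) (ex_intro2 _ _ 1 ler01 erefl).
by rewrite /h scale1r addNr p0 mul1r sub0r.
Qed.

(* Minimal sublinear functionals are linear: replacing p by its shift along y
   cannot decrease p, so p (- y) = - p y. *)
Lemma hahn_banach p : sublinear p ->
  exists f : {linear X -> R^o}, forall x, f x <= p x.
Proof.
move=> sp; pose T := {q : X -> R | sublinear q /\ forall x, q x <= p x}.
(* The order is reversed, so that Zorn's lemma yields a minimal functional. *)
pose le (q r : T) := `[< forall x, sval r x <= sval q x >].
have t0 : T by exists p.
have [||A totA|[q [sq qp]] qmin] := @ZL_preorder T t0 le.
- by move=> t; apply/asboolP => x.
- move=> r s t /asboolP rs /asboolP st; apply/asboolP => x.
  exact: le_trans (st x) (rs x).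
- have [[r0 Ar0]|A0] := pselect (A !=set0); last first.
    by exists t0 => s As; exfalso; apply: A0; exists s.
  have [||||q sq qA] := @inf_sublinear [set sval r | r in A] (fun x => - p (- x)).
  + by exists (sval r0), r0.
  + move=> _ x [[r [sr rp]] /= _ <-]; apply: le_trans (sublinearN x sr).
    by rewrite lerN2.
  + move=> _ _ x y [r Ar <-] [s As <-].
    have [] := totA r s Ar As => /asboolP rs.
      exists (sval s); first by exists s.
      by apply: le_trans ((svalP s).1.1 x y) _; rewrite lerD2r.
    exists (sval r); first by exists r.
    by apply: le_trans ((svalP r).1.1 x y) _; rewrite lerD2l.
  + move=> _ c x [r Ar <-] c0; exists (sval r); first by exists r.
    by rewrite (svalP r).1.2.
  have qp x : q x <= p x.
    by apply: le_trans ((svalP r0).2 x); apply: qA; exists r0.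
  exists (exist _ q (conj sq qp)) => s As; apply/asboolP => x /=.
  by apply: qA; exists s.
have qN y : q (- y) = - q y.
  have [r [sr rq ry]] := sublinear_shift y sq.
  have rp x : r x <= p x := le_trans (rq x) (qp x).
  have /asboolP qr : le (exist _ r (conj sr rp)) (exist _ q (conj sq qp)).
    by apply: qmin; apply/asboolP.
  apply/le_anti; rewrite (le_trans (qr _) ry)/=.
  by have := sublinearN (- y) sq; rewrite opprK; lra.
have qD x y : q (x + y) = q x + q y.
  apply/le_anti; rewrite sq.1/=.
  by have := sq.1 (x + y) (- y); rewrite addrK qN; lra.
have qZ (c : R) x : q (c *: x) = c * q x.
  have [c0|c0|->] := ltgtP c 0; last by rewrite scale0r mul0r (sublinear0 sq).
  - rewrite -[c *: x]opprK -scaleNr qN sq.2 ?oppr_gt0//.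
    by rewrite mulNr opprK.
  - exact: sq.2.
have q_lin : linear (q : X -> R^o) by move=> c x y; rewrite qD qZ.
pose f : {linear X -> R^o} := HB.pack (q : X -> R^o) (GRing.isLinear.Build _ _ _ _ _ q_lin).
by exists f.
Qed.

End hahn_banach.

(** * Norming functionals and separability *)

Section norming.
Variables (R : realType) (X : normedModType R).

(** Hahn-Banach is applied to the norm shifted along [x]: then [f (- x) <= - |x|], which gives
    [f x >= |x|]. *)
Lemma norming_functional (x : X) : exists f : {linear X -> R^o},
  (forall u, `|f u| <= `|u|) /\ f x = `|x|.
Proof.
have sn : sublinear (fun u : X => `|u|).
  by split=> [u v|c u c0]; [exact: ler_normD|rewrite normrZ gtr0_norm].
have [q [sq qn qx]] := sublinear_shift x sn.
have [f fq] := hahn_banach sq.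
have f1 u : `|f u| <= `|u|.
  rewrite ler_norml (le_trans (fq u) (qn u)) andbT lerNl -linearN.
  by apply: le_trans (fq _) _; rewrite -(normrN u).
exists f; split => //; apply/le_anti.
rewrite (le_trans (ler_norm _) (f1 x))/= -lerN2 -linearN.
exact: le_trans (fq _) qx.
Qed.

Lemma separable_seq : separable X ->
  exists d : nat -> X, forall x (e : R), 0 < e -> exists n, `|x - d n| < e.
Proof.
move=> [D /countable_injP[i iD] dD].
exists (fun n => xget 0 [set x | D x /\ i x = n]) => x e e0.
have [] := dD (ball x e); first by exists x; exact: ballxx.
  exact: ball_open.
move=> u [xu Du]; exists (i u); case: xgetP => [v _ [Dv iv]|/(_ u)]; last by case.
rewrite (iD _ _ _ _ iv) ?inE//.
by move: xu; rewrite -ball_normE.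
Qed.

(** The dense sequence may miss [C]: each pair (n, m) selects a point of [C] within [1 / (m + 1)] of
    [d n] if there is one, and [c0] otherwise. *)
Lemma separable_subset_seq (C : set X) : separable X -> C !=set0 ->
  exists c : nat -> X, (forall n, C (c n)) /\
    forall x (e : R), C x -> 0 < e -> exists n, `|x - c n| < e.
Proof.
move=> /separable_seq[d dP] [c0 Cc0].
pose near_d (nm : nat * nat) := [set u | C u /\ `|u - d nm.1| < nm.2.+1%:R^-1].
exists (fun k => xget c0 (near_d (odflt (0%N, 0%N) (unpickle k)))); split.
  by move=> n; case: xgetP => [v _ []|].
move=> x e Cx e0.
have [m me] : exists m : nat, m.+1%:R^-1 < e / 2.
  have /near_inftyP[m /(_ m (leqnn m))] := near_infty_natSinv_lt (PosNum (divr_gt0 e0 (ltr0n R 2))).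
  by exists m.
have [n xn] := dP x m.+1%:R^-1 ltac:(by rewrite invr_gt0 ltr0n).
exists (pickle (n, m)); rewrite pickleK/=.
case: xgetP => [v _ [_ /= vn]|/(_ x)]; last by case.
rewrite -(subrKA (d n)); apply: le_lt_trans (ler_normD _ _) _.
by rewrite [`|d n - v|]distrC (lt_trans (ltrD xn vn))// [ltRHS]splitr ltrD.
Qed.

(** Norming functionals of a dense sequence separate points: if all vanish at [x], then
    [|d n| = f n (d n - x) <= |x - d n|], impossible for [d n] close to a nonzero [x]. *)
Lemma separable_separating : separable X ->
  exists f : nat -> {linear X -> R^o}, (forall n, continuous (f n)) /\
    forall x, (forall n, f n x = 0) -> x = 0.
Proof.
move=> /separable_seq[d dP].
have /choice[f fP] := fun n => norming_functional (d n).
exists f; split=> [n|x fx].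
  by apply: (@linear_le_continuous _ _ _ 1) => u; rewrite mul1r (fP n).1.
apply/eqP; rewrite -normr_le0 leNgt; apply/negP => x0.
have [n xn] := dP x (`|x| / 2) ltac:(lra).
have [f1 fd] := fP n.
have : `|d n| <= `|x - d n|.
  rewrite -fd; apply: le_trans (f1 _).
  by rewrite linearB fx sub0r normrN ler_norm.
have : `|x| <= `|x - d n| + `|d n| by rewrite -{1}(subrK (d n) x) ler_normD.
by lra.
Qed.

End norming.

(** * Boundedness of weakly convergent sequences *)

Section weak_bounded.
Variables (R : realType) (X : normedModType R).

(* Gliding hump: f is a signed sum of 3^-k f_k, with f_k norming x (phi k); the
   k-th sign keeps the partial sum at x (phi k) at least 3^-k |x (phi k)|, and
   the remaining terms contribute at most half of that. *)
Lemma weak_cvg_bounded (x : nat -> X) (y : X) : weak_cvg x y ->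
  exists M : R, forall n, `|x n| <= M.
Proof.
move=> xy; apply: contrapT => nM.
have /choice[phi phiP] (k : nat) : exists n, 2 * k%:R * 3 ^+ k < `|x n|.
  apply: contrapT => H; apply: nM; exists (2 * k%:R * 3 ^+ k) => n.
  by rewrite leNgt; apply/negP => ?; apply: H; exists n.
pose z k := x (phi k).
have /choice[f fP] := fun k => norming_functional (z k).
pose w k : R := 3^-1 ^+ k.
have w0 k : 0 < w k by rewrite exprn_gt0.
have wS k : w k.+1 = w k / 3 by rewrite /w exprSr.
pose fix g k : X -> R := if k is k'.+1 then fun u =>
    g k' u + (if `|w k' * `|z k'| | <= `|g k' (z k') + w k' * `|z k'| | then 1 else -1)
      * (w k' * f k' u)
  else fun=> 0.
have g_lin k (c : R) u v : g k (c *: u + v) = c * g k u + g k v.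
  elim: k => [|k IH] /=; first by rewrite mulr0 addr0.
  by rewrite IH linearP /=; set s := (if _ then _ else _); rewrite /GRing.scale/=; ring.
have gS k u : `|g k.+1 u - g k u| <= w k * `|u|.
  rewrite /= addrC addKr normrM.
  by case: ifP => _; rewrite ?normrN normr1 mul1r normrM ger0_norm ?(ltW (w0 k))//
     ler_pM2l// (fP k).1.
have gk k : w k * `|z k| <= `|g k.+1 (z k)|.
  rewrite /= (fP k).2; set b := w k * `|z k|.
  have b0 : 0 <= b by rewrite mulr_ge0// ltW.
  case: ifP => [|/negbT]; rewrite (ger0_norm b0); first by rewrite mul1r.
  rewrite -ltNge mulN1r => gb.
  have := ler_norm (b *+ 2).
  have : `|b *+ 2| <= `|g k (z k) + b| + `|g k (z k) - b|.
    have -> : b *+ 2 = (g k (z k) + b) - (g k (z k) - b) by rewrite mulr2n; ring.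
    exact: ler_normB.
  by rewrite mulr2n; lra.
have gmk m k u : (k <= m)%N -> `|g m u - g k u| <= 3 / 2 * (w k - w m) * `|u|.
  move=> /subnKC <-; elim: (m - k)%N => [|j IH].
    by rewrite addn0 !subrr normr0 mulr0 mul0r.
  rewrite addnS -(subrKA (g (k + j)%N u)).
  apply: le_trans (ler_normD _ _) _; rewrite wS.
  by have := gS (k + j)%N u; have := IH; lra.
have g_cvg u : cvgn (fun k => g k u).
  apply/cauchy_cvgP/cauchy_exP => e e0.
  have : w k * `|u| @[k --> \oo] --> (0 : R).
    rewrite -[X in _ --> X](mul0r `|u|); apply: cvgM; last exact: cvg_cst.
    rewrite (_ : w = geometric 1 3^-1); last by apply/funext => k; rewrite /= mul1r.
    by apply: cvg_geometric; rewrite ger0_norm; lra.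
  move=> /cvgr0_norm_lt/(_ (e / 2) ltac:(lra))/near_inftyP[N /(_ N (leqnn N))].
  rewrite ger0_norm ?mulr_ge0 ?(ltW (w0 N))// => wN.
  exists (g N u); apply/near_inftyP; exists N => m Nm; rewrite -ball_normE /ball_/= distrC.
  apply: le_lt_trans (gmk m N u Nm) _.
  by have : 0 <= w m * `|u| by [rewrite mulr_ge0// ltW]; lra.
pose G u : R := limn (fun k => g k u).
have G_cvg u : g k u @[k --> \oo] --> G u := g_cvg u.
have G_lin : linear (G : X -> R^o).
  move=> c u v; apply/cvg_lim => //.
  under eq_cvg do rewrite g_lin.
  apply: cvgD; last exact: G_cvg.
  by apply: cvgM; [exact: cvg_cst|exact: G_cvg].
pose F : {linear X -> R^o} := HB.pack (G : X -> R^o) (GRing.isLinear.Build _ _ _ _ _ G_lin).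
have Gg k u : `|G u - g k u| <= 3 / 2 * w k * `|u|.
  have H : `|g m u - g k u| @[m --> \oo] --> `|G u - g k u|.
    by apply: (@cvg_norm _ R^o); apply: cvgB; [exact: G_cvg|exact: cvg_cst].
  rewrite -(cvg_lim _ H)//; apply: limr_le; first exact: (cvgP _ H).
  apply/near_inftyP; exists k => m km; apply: le_trans (gmk m k u km) _.
  by have : 0 <= w m * `|u| by [rewrite mulr_ge0// ltW]; lra.
have cF : continuous F.
  apply: (@linear_le_continuous _ _ _ (3 / 2)) => u.
  by have := Gg 0%N u; rewrite /= subr0 /w expr0 mulr1.
have /weak_cvgP/(_ F cF)/cvgP/cvg_seq_bounded[M [_ /(_ (M + 1))]] := xy.
rewrite ltrDl ltr01 => /(_ isT) FM.
have [k kM] : exists k, M + 1 < k%:R.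
  by exists (Num.bound `|M + 1|); exact: le_lt_trans (ler_norm _) (archi_boundP (normr_ge0 _)).
have zk : k%:R <= 2^-1 * (w k * `|z k|).
  have := phiP k; rewrite -/(z k) => /ltW zk.
  have : w k * (2 * k%:R * 3 ^+ k) <= w k * `|z k| by rewrite ler_pM2l.
  have w3 : w k * 3 ^+ k = 1 by rewrite /w -exprMn mulVf ?expr1n ?pnatr_eq0.
  by rewrite mulrCA w3 mulr1 ler_pdivlMl.
have /= := FM (phi k) I; rewrite -/(z k) => Gz.
have := Gg k.+1 (z k); rewrite wS; have := gk k.
have : `|g k.+1 (z k)| <= `|G (z k)| + `|G (z k) - g k.+1 (z k)|.
  by rewrite -{1}(subKr (G (z k)) (g k.+1 (z k))) ler_normB.
by move: Gz kM zk; rewrite -/(w k); lra.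
Qed.

End weak_bounded.

(** * Sequential compactness of weakly compact sets (Eberlein-Smulian) *)

Section eberlein_smulian.
Variables (R : realType) (X : normedModType R).

Lemma weak_nbhs_functional (p : X) (f : {linear X -> R^o}) (e : R) : continuous f -> 0 < e ->
  nbhs (p : weak_topology X) [set u | `|f u - f p| < e].
Proof.
move=> cf e0; pose F := nbhs (p : weak_topology X).
have /cvgrPdist_lt/(_ e e0) : f u @[u --> F] --> f p.
  by move: f cf; apply/(@weak_topology_cvgP R X F p _); exact: cvg_id.
by apply: filterS => u; rewrite distrC.
Qed.

Lemma weak_cluster (z : nat -> X) (p : X) (f : {linear X -> R^o}) (e : R) (P : nat -> Prop) :
  cluster (z @ \oo : set_system (weak_topology X)) p -> continuous f -> 0 < e ->
  (\forall n \near \oo, P n) -> exists2 n, P n & `|f (z n) - f p| < e.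
Proof.
move=> zp cf e0 zP.
have zPz : (z @ \oo) (z @` [set n | P n]).
  by apply: filterS zP => n Pn; exists n.
by have [_ [[n Pn <-] fzn]] := zp _ _ zPz (weak_nbhs_functional p cf e0); exists n.
Qed.

Lemma weak_compact_subseq (C : set X) (x : nat -> X) : separable X ->
  compact (C : set (weak_topology X)) -> (forall n, C (x n)) ->
  exists (phi : nat -> nat) (p : X),
    [/\ forall n, (n <= phi n)%N, C p & weak_cvg (x \o phi) p].
Proof.
move=> /separable_separating[f [cf f_sep]] cC xC.
have cluster_pt (z : nat -> X) : (forall n, C (z n)) ->
    exists2 p, C p & cluster (z @ \oo : set_system (weak_topology X)) p.
  move=> zC; have zCoo : (z @ \oo) C by apply/near_inftyP; exists 0%N => n _; exact: zC.
  by have [p [Cp zp]] := cC (z @ \oo) _ zCoo; exists p.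
have [p Cp xp] := cluster_pt x xC.
have near_p k : exists2 n, (k <= n)%N & forall i, (i < k)%N -> `|f i (x n) - f i p| < k%:R^-1.
  have [->|k0] := posnP k; first by exists 0%N.
  have nb : nbhs (p : weak_topology X) [set u | forall i, (i < k)%N -> `|f i u - f i p| < k%:R^-1].
    suff H j : nbhs (p : weak_topology X)
      [set u | forall i, (i < j)%N -> `|f i u - f i p| < k%:R^-1] by exact: H.
    elim: j => [|j IH]; first by apply: filterS filterT => u _ i; rewrite ltn0.
    have ki0 : (0 : R) < k%:R^-1 by rewrite invr_gt0 ltr0n.
    apply: filterS2 IH (weak_nbhs_functional p (cf j) ki0) => u IH fj i.
    by rewrite ltnS leq_eqVlt => /predU1P[->|/IH].
  have xk : (x @ \oo) (x @` [set n | (k <= n)%N]).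
    by apply/near_inftyP; exists k => n kn; exists n.
  by have [_ [[n kn <-] xn]] := xp _ _ xk nb; exists n.
have /choice[phi phiP] : forall k, exists n, (k <= n)%N /\
    forall i, (i < k)%N -> `|f i (x n) - f i p| < k%:R^-1.
  by move=> k; have [n ? ?] := near_p k; exists n.
exists phi, p; split => // [n|]; first by have [] := phiP n.
apply/weak_cvgP => h ch; apply/cvgrPdist_lt => e e0; apply/near_inftyP.
apply: contrapT => H.
have /frequently_subseq[psi psin psiP] N : exists2 n, (N <= n)%N & e <= `|h p - h (x (phi n))|.
  apply: contrapT => H2; apply: H; exists N => n Nn; rewrite ltNge; apply/negP => ?.
  by apply: H2; exists n.
have [q Cq xq] := cluster_pt (x \o phi \o psi) (fun n => xC _).
have pq : q = p.
  apply/eqP; rewrite -subr_eq0; apply/eqP/f_sep => i; rewrite linearB.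
  apply/eqP; rewrite -normr_le0 leNgt; apply/negP => fi0.
  have [|n [ni nd] fn] := weak_cluster xq (cf i) (e := `|f i q - f i p| / 2)
      (P := fun n => (i < n)%N /\ n%:R^-1 < `|f i q - f i p| / 2) ltac:(lra).
    apply: filterI; first by apply/near_inftyP; exists i.+1.
    apply/near_inftyP; exists (Num.bound (`|f i q - f i p| / 2)^-1) => n nb.
    have n0 : (0 < n)%N.
      apply: leq_trans nb; rewrite -(ltr_nat R).
      by apply: le_lt_trans (archi_boundP _); rewrite ?invr_ge0; lra.
    rewrite invf_plt ?posrE ?ltr0n//; last by lra.
    apply: lt_le_trans (archi_boundP _) _; first by rewrite invr_ge0; lra.
    by rewrite ler_nat.
  have [_ /(_ i)] := phiP (psi n); rewrite (leq_trans ni (psin n)) => /(_ isT) fp.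
  have : (psi n)%:R^-1 <= n%:R^-1 :> R.
    have n0 : (0 < n)%N := leq_ltn_trans (leq0n i) ni.
    by rewrite lef_pV2 ?posrE ?ltr0n ?(leq_trans n0 (psin n))// ler_nat.
  have : `|f i q - f i p| <= `|f i (x (phi (psi n))) - f i q| + `|f i (x (phi (psi n))) - f i p|.
    by rewrite [`|_ - f i q|]distrC -{1}(subrKA (f i (x (phi (psi n))))) ler_normD.
  by move: fn => /=; lra.
have [n _] := weak_cluster xq ch e0 (nearW _ (fun=> I)).
by rewrite pq distrC ltNge psiP.
Qed.

End eberlein_smulian.

(** * From (e) to weak normal structure *)

Section normal_structure.
Variables (R : realType) (X : normedModType R).

Lemma convex_mem (C : set X) (t : R) u v : convex_set C -> C u -> C v ->
  0 <= t <= 1 -> C (t *: u + (1 - t) *: v).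
Proof.
move=> cvxC Cu Cv /andP[t0 t1].
exact: set_mem (cvxC u v (Itv01 t0 t1) (mem_set Cu) (mem_set Cv)).
Qed.

Lemma weak_compact_bounded (C : set X) : separable X ->
  compact (C : set (weak_topology X)) -> exists M : R, forall u, C u -> `|u| <= M.
Proof.
move=> sX cC; apply: contrapT => nM.
have /choice[x xP] (n : nat) : exists u, C u /\ n%:R < `|u|.
  apply: contrapT => H; apply: nM; exists n%:R => u Cu; rewrite leNgt.
  by apply/negP => ?; apply: H; exists u.
have [phi [p [phin _ /weak_cvg_bounded[M xM]]]] :=
  weak_compact_subseq sX cC (fun n => (xP n).1).
have Mn : M < (Num.bound M)%:R := archi_boundP (le_trans (normr_ge0 _) (xM 0%N)).
have : M < `|x (phi (Num.bound M))|.
  apply: lt_trans (xP (phi _)).2; apply: lt_le_trans Mn _.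
  by rewrite ler_nat.
by rewrite ltNge xM.
Qed.

(* The average w n gives each of c 0, ..., c n weight at least 2^-(n+1), so a point
   at distance d - 4^-(n+1) from w n is at distance d - 2^-(n+1) from each of them. *)
Lemma convex_far_points (C : set X) (c : nat -> X) (d : R) : convex_set C ->
  (forall n, C (c n)) -> (forall u v, C u -> C v -> `|u - v| <= d) ->
  (forall w, C w -> forall e : R, 0 < e -> exists2 u, C u & d - e < `|w - u|) ->
  exists x : nat -> X, (forall n, C (x n)) /\
    forall u, C u -> (forall e : R, 0 < e -> exists n, `|u - c n| < e) ->
      forall e : R, 0 < e -> \forall n \near \oo, d - e <= `|x n - u|.
Proof.
move=> cvxC cC Cd far.
pose fix w n := if n is n'.+1 then 2^-1 *: w n' + (1 - 2^-1) *: c n else c 0%N.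
have wC n : C (w n).
  by elim: n => [|n IH] //=; apply: convex_mem => //; lra.
have wfar n i u : C u -> (i <= n)%N ->
    `|w n - u| <= d - 2^-1 ^+ n.+1 * (d - `|c i - u|).
  move=> Cu; have du v : C v -> `|v - u| <= d by move=> Cv; exact: Cd.
  elim: n => [|n IH].
    rewrite leqn0 => /eqP ->; rewrite expr1 /=.
    by have := du _ (cC 0%N); lra.
  have -> : w n.+1 - u = 2^-1 *: (w n - u) + 2^-1 *: (c n.+1 - u).
    rewrite [w n.+1]/=; have -> : 1 - 2^-1 = 2^-1 :> R by lra.
    rewrite !scalerBr addrACA -opprD -scalerDl.
    by have -> : 2^-1 + 2^-1 = 1 :> R; [lra|rewrite scale1r].
  have wn : `|2^-1 *: (w n - u) + 2^-1 *: (c n.+1 - u)| <=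
      2^-1 * `|w n - u| + 2^-1 * `|c n.+1 - u|.
    by apply: le_trans (ler_normD _ _) _; rewrite !normrZ ger0_norm// invr_ge0.
  move=> in1; apply: le_trans wn _; rewrite exprS; move: in1.
  have e0 : 0 < 2^-1 ^+ n.+1 :> R by rewrite exprn_gt0.
  have e1 : 2^-1 ^+ n.+1 <= 1 :> R by rewrite exprn_ile1//; lra.
  rewrite leq_eqVlt => /predU1P[->|].
    by have := du _ (wC n); have := du _ (cC n.+1); nra.
  by rewrite ltnS => /IH; have := du _ (cC n.+1); lra.
have /choice[x xP] n : exists u, C u /\ d - 4^-1 ^+ n.+1 < `|w n - u|.
  by have [u ? ?] := far (w n) (wC n) (4^-1 ^+ n.+1) ltac:(by rewrite exprn_gt0); exists u.
exists x; split=> [n|u Cu cu e e0]; first by have [] := xP n.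
have [i ui] := cu (e / 2) ltac:(lra).
have : (2^-1 : R) ^+ n @[n --> \oo] --> (0 : R).
  rewrite (_ : (fun n => _) = geometric 1 2^-1).
    by apply: cvg_geometric; rewrite ger0_norm; lra.
  by apply/funext => n; rewrite /= mul1r.
move=> /cvgr0_norm_lt/(_ (e / 2) ltac:(lra))/near_inftyP[N Ne].
apply/near_inftyP; exists (maxn i N) => n; rewrite geq_max => /andP[in_ Nn].
have [Cx xw] := xP n.
have := wfar n i (x n) Cx in_; set t : R := 2^-1 ^+ n.+1.
have tt : 4^-1 ^+ n.+1 = t * t.
  by rewrite /t -exprMn; congr (_ ^+ _); lra.
have t0 : 0 < t by rewrite exprn_gt0.
rewrite tt in xw => wx.
have : d - `|c i - x n| < t by rewrite -(ltr_pM2l t0); lra.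
have := Ne n.+1 (leqW Nn); rewrite ger0_norm ?(ltW t0)// -/t => te.
have : `|c i - x n| <= `|u - c i| + `|x n - u|.
  rewrite [`|u - _|]distrC [`|x n - u|]distrC.
  by have -> : c i - x n = (c i - u) + (u - x n); [rewrite subrKA|exact: ler_normD].
by lra.
Qed.

Lemma opial_weak_normal_structure : separable X ->
  (0 < opial_modulus X 1)%E -> weak_normal_structure X.
Proof.
move=> sX /opial_modulus_gap[delta /andP[d0 d1] E] C cC cvxC [u0 [v0 [Cu0 Cv0 uv0]]].
apply: contrapT => noC.
have [M CM] := weak_compact_bounded sX cC.
have diam_le (u v : X) : C u -> C v -> (`|u - v|%:E <= diam C)%E.
  by move=> Cu Cv; apply: ereal_sup_ubound; exists (u, v).
have : (diam C <= (M + M)%:E)%E.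
  apply: ge_ereal_sup => _ [[u v] [/= Cu Cv] <-]; rewrite lee_fin.
  by apply: le_trans (ler_normB _ _) _; rewrite lerD// CM.
case dE : (diam C) (diam_le u0 v0 Cu0 Cv0) => [d| |] // uvd _.
have dp : 0 < d.
  by rewrite lee_fin in uvd; apply: lt_le_trans uvd; rewrite normr_gt0 subr_eq0.
have Cd (u v : X) : C u -> C v -> `|u - v| <= d.
  by move=> Cu Cv; rewrite -lee_fin -dE; exact: diam_le.
(* Without normal structure every point of [C] has distances to [C] with supremum at least [d]. *)
have far w : C w -> forall e : R, 0 < e -> exists2 u, C u & d - e < `|w - u|.
  move=> Cw e e0.
  have : ((d - e)%:E < ereal_sup [set `|w - y|%:E | y in C])%E.
    apply: (@lt_le_trans _ _ d%:E); first by rewrite lte_fin; lra.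
    by rewrite leNgt -dE; apply/negP => ?; apply: noC; exists w.
  by move=> /ereal_sup_gt[_ [u Cu <-]]; rewrite lte_fin => ?; exists u.
have [c [cC' c_dense]] := separable_subset_seq sX (ex_intro _ u0 Cu0).
have [x [xC x_far]] := convex_far_points cvxC cC' Cd far.
have [phi [p [phin Cp xp]]] := weak_compact_subseq sX cC xC.
have /near_inftyP[N xN] := x_far p Cp (fun e => c_dense p e Cp) (d * delta / 4) ltac:(nra).
pose z n := x (phi (n + N)%N) - p.
have z0 : weak_cvg z 0.
  exact: (@weak_cvg_subseq _ _ _ _ (addn^~ N) (fun n => leq_addr _ _) (weak_cvgB0 xp)).
have sz n : d - d * delta / 4 <= `|z n|.
  by apply: xN; apply: leq_trans (phin _); exact: leq_addl.
(* At level [s = d - d * delta / 4] the gap yields a distance of at least [(1 + delta) * s > d],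
   although [z n - z 0] is a difference of two points of [C]. *)
have [|n] := E z (z 0%N) (d - d * delta / 4) z0 _ (sz 0%N) sz; first by nra.
have -> : z n - z 0%N = x (phi (n + N)%N) - x (phi (0 + N)%N) by rewrite /z opprB addrA subrK.
have := Cd _ _ (xC (phi (n + N)%N)) (xC (phi (0 + N)%N)).
have dd0 : 0 < d * delta by rewrite mulr_gt0.
have : d * delta * delta <= d * delta by rewrite ler_piMr// ltW.
by lra.
Qed.

End normal_structure.

Unset Implicit Arguments.
Set Strict Implicit.

(* Schur spaces satisfy the other four conditions but, by definition, not
   property_K; so property_K enters the equivalence exactly off Schur spaces. *)
Theorem theorem3p1 (R : realType) (X : completeNormedModType R)
    (sepX : separable X) (MX : property_M X) :
  [<-> ~ contains_c0 X;
       weak_normal_structure X;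
       kadec_klee X;
       (0 < opial_modulus X 1)%E]
  /\
  (~ schur X ->
   [<-> ~ contains_c0 X;
        weak_normal_structure X;
        property_K X;
        kadec_klee X;
        (0 < opial_modulus X 1)%E]).
Proof.
have ea : (0 < opial_modulus X 1)%E -> ~ contains_c0 X := @opial_no_c0 R X.
have ae : ~ contains_c0 X -> (0 < opial_modulus X 1)%E := no_c0_opial MX.
have eb : (0 < opial_modulus X 1)%E -> weak_normal_structure X :=
  opial_weak_normal_structure sepX.
have be : weak_normal_structure X -> (0 < opial_modulus X 1)%E :=
  weak_normal_structure_opial MX.
have de : kadec_klee X -> (0 < opial_modulus X 1)%E := kadec_klee_opial MX.
have ed : (0 < opial_modulus X 1)%E -> kadec_klee X := opial_kadec_klee MX.
split; first by tfae; auto.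
move=> nS; have ec := @opial_property_K R X nS; have ce := property_K_opial MX.
by tfae; auto.
Qed.
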